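(* Let $A$ be an artin $R$-algebra and let $M\in\mathrm{mod}(A)$. Then $$\phi(M)=\max\bigl(\{d\in\mathbb{N} : \text{there is a } d\text{-Division of } M\}\cup\{0\}\bigr).$$
   Context: $R$ is a commutative artinian ring, and $\mathrm{mod}(A)$ is the category of finitely generated left $A$-modules. $\mathcal{C}_A$ denotes the abelian category of all $R$-functors (i.e. $R$-linear functors) $F:\mathrm{mod}(A)\to\mathrm{mod}(R)$. For $M\in\mathrm{mod}(A)$, $\mathrm{add}(M)$ is the class of direct summands of finite direct sums of copies of $M$. Igusa-Todorov function $\phi$: Let $K(A)$ be the quotient of the free abelian group generated by the isomorphism classes $[M]$ of modules $M\in\mathrm{mod}(A)$ modulo the relations (a) $[N]-[S]-[T]$ if $N\simeq S\oplus T$ and (b) $[P]$ if $P$ is projective. Thus $K(A)$ is the free abelian group on the isomorphism classes of finitely generated indecomposable non-projective $A$-modules. The syzygy induces a group homomorphism $\Omega:K(A)\to K(A)$, $\Omega([M]):=[\Omega(M)]$. Let $\langle M\rangle$ be the subgroup of $K(A)$ generated by the indecomposable non-projective direct summands of $M$. Then $\phi(M)$ is the smallest non-negative integer such that $\Omega:\Omega^n(\langle M\rangle)\to\Omega^{n+1}(\langle M\rangle)$ is an isomorphism for all $n\geq\phi(M)$. $d$-Division: for a positive integer $d$ and $M\in\mathrm{mod}(A)$, a pair $(X,Y)$ of objects in $\mathrm{add}(M)$ is called a $d$-Division of $M$ if: (a) $\mathrm{add}(X)\cap\mathrm{add}(Y)=\{0\}$; (b) $\mathrm{Ext}^d_A(X,-)\not\simeq\mathrm{Ext}^d_A(Y,-)$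 in $\mathcal{C}_A$; (c) $\mathrm{Ext}^{d+1}_A(X,-)\simeq\mathrm{Ext}^{d+1}_A(Y,-)$ in $\mathcal{C}_A$. *)

(* Defs.v *)
From HB Require Import structures.
From mathcomp Require Import all_boot all_algebra generic_quotient ring_quotient.
From mathcomp Require Import boolp classical_sets functions.
From mathcomp.multinomials Require Import freeg.

Set Implicit Arguments.
Unset Strict Implicit.
Unset Printing Implicit Defensive.

Import GRing.Theory.
Local Open Scope ring_scope.
Local Open Scope quotient_scope.
Local Open Scope classical_set_scope.

Definition fin_gen (A : nzRingType) (M : lmodType A) : Prop :=
  exists (n : nat) (s : 'I_n -> M),
    forall x, exists c : 'I_n -> A, x = \sum_i c i *: s i.

(* Descending chain condition on ideals, i.e. submodules of the regular module. *)
Definition artinian (R : comNzRingType) : Prop :=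
  forall I : nat -> {pred R^o},
    (forall n, submod_closed (I n)) ->
    (forall n, {subset I n.+1 <= I n}) ->
    exists N, forall n, (N <= n)%N -> I n =i I N.

Definition artin_algebra (R : comNzRingType) (A : algType R) : Prop :=
  artinian R /\ fin_gen (A : lmodType R).

Record modA (A : nzRingType) := ModA {
  mod_sort :> lmodType A;
  mod_fin_gen : fin_gen mod_sort
}.

Section Modules.
Variable A : nzRingType.
Implicit Types (U V P : lmodType A) (M N X Y : modA A).

Definition surj U V (f : U -> V) : Prop := forall v, exists u, f u = v.

Definition isomorphic U V : Prop := exists f : {linear U -> V}, bijective f.

Definition trivial_module U : Prop := forall u : U, u = 0.

Definition direct_summand U V : Prop :=
  exists U' : lmodType A, isomorphic V (U * U')%type.

Definition indecomposable U : Prop :=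
  ~ trivial_module U /\
  forall S T : lmodType A, isomorphic U (S * T)%type ->
    trivial_module S \/ trivial_module T.

Definition in_add M X : Prop :=
  exists n : nat, direct_summand X {ffun 'I_n -> M}.

Definition projective P : Prop :=
  forall (U V : lmodType A) (g : {linear U -> V}) (f : {linear P -> V}),
    surj g -> exists h : {linear P -> U}, forall x, g (h x) = f x.

Definition superfluous U (K : set U) : Prop :=
  forall W : {pred U}, submod_closed W ->
    (forall u, exists k w, [/\ K k, w \in W & u = k + w]) ->
    forall u, u \in W.

Definition projective_cover P U (f : {linear P -> U}) : Prop :=
  [/\ projective P, surj f & superfluous [set x | f x = 0]].

(* N is a syzygy of M, i.e. there is a short exact sequence
   0 -> N -> P -> M -> 0 with P -> M a projective cover in mod(A). *)
Definition is_syzygy M N : Prop :=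
  exists (P : modA A) (f : {linear P -> M}) (i : {linear N -> P}),
    [/\ projective_cover f, injective i
      & forall x, f x = 0 <-> exists y, i y = x].

End Modules.

Section GrothendieckGroup.
Variable A : nzRingType.
Implicit Types M N P S T X : modA A.

(* Isomorphism classes of f.g. modules must form a small type, as they generate
   a free abelian group below. The class of M is therefore encoded as the set of
   all submodules N of some A^n such that M is isomorphic to A^n/N. *)
Definition presentation : Type := {n : nat & set 'rV[A]_n}.

Definition presents (M : lmodType A) (p : presentation) : Prop :=
  exists f : {linear 'rV[A]_(tag p) -> M},
    surj f /\ tagged p = [set x | f x = 0].

Definition isoclass : Type :=
  {c : set presentation | exists M : modA A, c = presents M}.

HB.instance Definition _ := gen_eqMixin isoclass.
HB.instance Definition _ := gen_choiceMixin isoclass.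

Definition iso_class M : isoclass :=
  exist _ (presents M : set presentation) (ex_intro _ M erefl).

Definition gen_subgroup (G : zmodType) (E : set G) : {pred G} :=
  fun x => `[< forall U : {pred G},
                 zmod_closed U -> (forall e, E e -> e \in U) -> x \in U >].

Lemma gen_subgroup_closed (G : zmodType) (E : set G) :
  zmod_closed (gen_subgroup E).
Proof.
split; first by apply/asboolP=> U [].
move=> x y /asboolP Ex /asboolP Ey; apply/asboolP=> U cU EU.
by case: (cU) => _; apply; [exact: Ex | exact: Ey].
Qed.

HB.instance Definition _ (G : zmodType) (E : set G) :=
  GRing.isZmodClosed.Build G (gen_subgroup E) (gen_subgroup_closed E).

Definition K_free := {freeg isoclass / int}.

Definition K_relation (x : K_free) : Prop :=
  (exists N S T : modA A, isomorphic N (S * T)%type /\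
     x = << iso_class N >> - << iso_class S >> - << iso_class T >>) \/
  (exists2 P : modA A, projective P & x = << iso_class P >>).

Definition K_group : zmodType := Quotient.quot (gen_subgroup K_relation).

Definition K_class M : K_group :=
  \pi_(Quotient.quot (gen_subgroup K_relation)) << iso_class M >>.

Definition K_span M : {pred K_group} :=
  gen_subgroup [set x | exists X : modA A, [/\ indecomposable X, ~ projective X,
                                   direct_summand X M & x = K_class X]].

(* The endomorphism Omega of K(A), characterized by [M] |-> [Omega M]. *)
Definition syzygy_morphism (Om : {additive K_group -> K_group}) : Prop :=
  forall M N, is_syzygy M N -> Om (K_class M) = K_class N.

Definition K_span_iter (Om : {additive K_group -> K_group}) M (n : nat) :
  set K_group := iter n Om @` [set` K_span M].

(* A bijective restriction of the additive map Om is a group isomorphism. *)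
Definition syzygy_stable (Om : {additive K_group -> K_group}) M (k : nat) :=
  forall n, (k <= n)%N ->
    set_bij (K_span_iter Om M n) (K_span_iter Om M n.+1) Om.

(* phi(M) = k; the existence of Omega on K(A) and of a k are part of the claim. *)
Definition is_phi M (k : nat) : Prop :=
  exists2 Om : {additive K_group -> K_group}, syzygy_morphism Om &
    syzygy_stable Om M k /\
    forall m, syzygy_stable Om M m -> (k <= m)%N.

End GrothendieckGroup.

Lemma iso_classP (A : nzRingType) (M N : modA A) :
  iso_class M = iso_class N <-> isomorphic M N.
Proof.
split=> [/(congr1 (@proj1_sig _ _)) /= eqMN|[f [g fK gK]]].
  have [n [s sM]] := mod_fin_gen M.
  pose h (x : 'rV[A]_n) : M := \sum_i x 0 i *: s i.
  have h_lin : linear h.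
    move=> a x y; rewrite /h scaler_sumr -big_split /=.
    by apply: eq_bigr => i _; rewrite !mxE scalerDl scalerA.
  have [hL hs] : exists f : {linear 'rV[A]_n -> M}, surj f.
    exists (HB.pack_for {linear 'rV[A]_n -> M} h
      (GRing.isLinear.Build A 'rV[A]_n M *:%R h h_lin)) => y.
    have [c ->] := sM y; exists (\row_i c i).
    by apply: eq_bigr => i _; rewrite mxE.
  have pM : presents M (existT _ n [set x | hL x = 0]) by exists hL.
  have : presents N (existT _ n [set x | hL x = 0]) by rewrite -eqMN.
  case=> k /= [ks kE].
  have ker x : hL x = 0 <-> k x = 0.
    by have /= -> : [set x | hL x = 0] x = [set x | k x = 0] x by rewrite kE.
  pose r y := projT1 (cid (hs y)).
  have rK y : hL (r y) = y by rewrite /r; case: cid.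
  have kr x : k (r (hL x)) = k x.
    by apply/eqP; rewrite -subr_eq0 -linearB; apply/eqP/ker;
       rewrite linearB rK subrr.
  pose F y := k (r y).
  have F_lin : linear F.
    move=> a x y; rewrite /F -{1}(rK x) -{1}(rK y) -linearP kr.
    by rewrite linearP.
  pose FL := HB.pack_for {linear M -> N} F
    (GRing.isLinear.Build A M N *:%R F F_lin).
  exists FL.
  pose q z := projT1 (cid (ks z)).
  have qK z : k (q z) = z by rewrite /q; case: cid.
  exists (fun z => hL (q z)) => [x|z] /=; last by rewrite /F kr qK.
  rewrite -[in RHS](rK x); apply/eqP; rewrite -subr_eq0 -linearB.
  by apply/eqP/ker; rewrite linearB qK /F subrr.
have g_lin : linear g.
  by move=> a x y; apply: (can_inj fK); rewrite linearP !gK.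
have [gL gE] : exists g' : {linear N -> M}, g' =1 g.
  by exists (HB.pack_for {linear N -> M} g
    (GRing.isLinear.Build A N M *:%R g g_lin)).
apply: eq_exist => /=; apply/funext=> p; apply/propext; split.
- case=> h [hs hE]; exists (f \o h)%FUN; split=> [y|].
    by have [x hx] := hs (g y); exists x; rewrite /= hx gK.
  rewrite hE; apply/seteqP; split=> x /= => [->|fh0]; first exact: raddf0.
  by apply: (can_inj fK); rewrite fh0 raddf0.
- case=> h [hs hE]; exists (gL \o h)%FUN; split=> [y|].
    by have [x hx] := hs (f y); exists x; rewrite /= hx gE fK.
  rewrite hE; apply/seteqP; split=> x /= => [->|fh0]; first exact: linear0.
  by apply: (can_inj gK); rewrite -gE fh0 -gE linear0.
Qed.

(* Objects of C_A and their isomorphisms. Values are allowed in all R-modules;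
   since mod(R) is a full subcategory, this does not affect isomorphism of
   functors with finitely generated values. *)
Record rfunctor (R : comNzRingType) (A : algType R) := RFunctor {
  fobj :> modA A -> lmodType R;
  fmap : forall U V : modA A, {linear U -> V} -> {linear fobj U -> fobj V};
  fmap_id : forall (U : modA A) x, fmap (idfun : {linear U -> U}) x = x;
  fmap_comp : forall (U V W : modA A) (g : {linear V -> W}) (f : {linear U -> V}) x,
    fmap (g \o f : {linear U -> W})%FUN x = fmap g (fmap f x);
  fmap_linear : forall (U V : modA A) (a : R) (f g h : {linear U -> V}),
    (forall u, h u = a%:A *: f u + g u) ->
    forall x, fmap h x = a *: fmap f x + fmap g x
}.

Definition rfunctor_iso (R : comNzRingType) (A : algType R)
    (F G : rfunctor A) : Prop :=
  exists eta : forall U : modA A, {linear F U -> G U},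
    (forall U, bijective (eta U)) /\
    forall (U V : modA A) (h : {linear U -> V}) (x : F U),
      eta V (fmap F h x) = fmap G h (eta U x).

Section QuotientModule.
Variables (R : nzRingType) (V : lmodType R) (I : submodClosed V).

(* submodClosed does not inherit from zmodClosed, which Quotient.quot needs. *)
Definition submod_subgroup : {pred V} := I.

HB.instance Definition _ := GRing.isZmodClosed.Build V submod_subgroup
  (GRing.submod_closedB (submodClosedP I)).

Definition quot_mod : Type := Quotient.quot submod_subgroup.

HB.instance Definition _ := Choice.on quot_mod.
HB.instance Definition _ := GRing.Zmodule.on quot_mod.

Definition quot_pi (x : V) : quot_mod := \pi_(Quotient.quot submod_subgroup) x.

Lemma quot_piP x y : quot_pi x = quot_pi y <-> x - y \in I.
Proof.
rewrite -[_ \in I]/(x - y \in submod_subgroup) Quotient.idealrBE; split=> [h|/eqP//]; apply/eqP; exact: h.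
Qed.

Lemma quot_pi_surj (q : quot_mod) : exists x, quot_pi x = q.
Proof. by exists (repr q); rewrite /quot_pi reprK. Qed.

Lemma quot_pi_additive : zmod_morphism quot_pi.
Proof. exact: (@raddfB _ _ (\pi_(Quotient.quot submod_subgroup) : {additive V -> _})). Qed.

Definition quot_scale (a : R) (q : quot_mod) : quot_mod :=
  quot_pi (a *: repr (q : Quotient.quot submod_subgroup)).

Lemma quot_pi_scale a x : quot_scale a (quot_pi x) = quot_pi (a *: x).
Proof.
apply/quot_piP; rewrite -scalerBr rpredZ //; apply/quot_piP.
by rewrite /quot_pi reprK.
Qed.

HB.instance Definition _ :=
  GRing.isZmodMorphism.Build V quot_mod quot_pi quot_pi_additive.

Lemma quot_scaleA a b q : quot_scale a (quot_scale b q) = quot_scale (a * b) q.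
Proof. by have [x <-] := quot_pi_surj q; rewrite !quot_pi_scale scalerA. Qed.
Lemma quot_scale1 : left_id 1 quot_scale.
Proof. by move=> q; have [x <-] := quot_pi_surj q; rewrite quot_pi_scale scale1r. Qed.
Lemma quot_scaleDr : right_distributive quot_scale +%R.
Proof.
move=> a p q; have [x <-] := quot_pi_surj p; have [y <-] := quot_pi_surj q.
by rewrite -raddfD !quot_pi_scale scalerDr raddfD.
Qed.
Lemma quot_scaleDl q : {morph quot_scale^~ q : a b / a + b}.
Proof.
by move=> a b; have [x <-] := quot_pi_surj q; rewrite !quot_pi_scale scalerDl raddfD.
Qed.

HB.instance Definition _ := GRing.Zmodule_isLmodule.Build R quot_mod
  quot_scaleA quot_scale1 quot_scaleDr quot_scaleDl.

Lemma quot_pi_scalable : scalable quot_pi.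
Proof. by move=> a x; rewrite -quot_pi_scale. Qed.
HB.instance Definition _ :=
  GRing.isScalable.Build R V quot_mod *:%R quot_pi quot_pi_scalable.

End QuotientModule.

Section QuotientMap.
Variables (R : nzRingType) (V W : lmodType R).
Variables (I : submodClosed V) (J : submodClosed W) (f : {linear V -> W}).
Hypothesis fIJ : forall x, x \in I -> f x \in J.

Definition quot_map (q : quot_mod I) : quot_mod J :=
  quot_pi J (f (repr (q : Quotient.quot (submod_subgroup I)))).

Lemma quot_mapE x : quot_map (quot_pi I x) = quot_pi J (f x).
Proof.
apply/quot_piP; rewrite -raddfB fIJ //; apply/quot_piP.
by rewrite /quot_pi reprK.
Qed.

Lemma quot_map_linear : linear quot_map.
Proof.
move=> a p q; have [x <-] := quot_pi_surj p; have [y <-] := quot_pi_surj q.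
by rewrite -linearP !quot_mapE !linearP.
Qed.

Definition quot_lmap : {linear quot_mod I -> quot_mod J} :=
  HB.pack_for {linear quot_mod I -> quot_mod J} quot_map
    (GRing.isLinear.Build R _ _ *:%R quot_map quot_map_linear).

End QuotientMap.

Section HomModule.
Variables (R : comNzRingType) (A : algType R) (U V : lmodType A).

(* Hom_A(U, V) as an R-module, R acting through R -> A. *)
Definition Hom : Type := {linear U -> V}.

HB.instance Definition _ := gen_eqMixin Hom.
HB.instance Definition _ := gen_choiceMixin Hom.

Definition hom_fun (f : Hom) : U -> V := (f : {linear U -> V}).

Lemma hom_ext (f g : Hom) : hom_fun f =1 hom_fun g -> f = g.
Proof.
case: f => f cf; case: g => g cg; rewrite /hom_fun /= => /funext fg.
case: _ / fg in cg *; congr GRing.Linear.Pack.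
case: cf cg => [[fa] [fb]] [[ga] [gb]].
by rewrite (Prop_irrelevance fa ga) (Prop_irrelevance fb gb).
Qed.

Definition hom_zero : Hom := (\0 : {linear U -> V})%R.
Definition hom_add (f g : Hom) : Hom :=
  ((f : {linear U -> V}) \+ (g : {linear U -> V}) : {linear U -> V})%R.
Definition hom_opp (f : Hom) : Hom :=
  (\- (f : {linear U -> V}) : {linear U -> V})%R.

Lemma hom_addA : associative hom_add.
Proof. by move=> f g h; apply: hom_ext => x; rewrite /hom_fun /= addrA. Qed.
Lemma hom_addC : commutative hom_add.
Proof. by move=> f g; apply: hom_ext => x; rewrite /hom_fun /= addrC. Qed.
Lemma hom_add0 : left_id hom_zero hom_add.
Proof. by move=> f; apply: hom_ext => x; rewrite /hom_fun /= add0r. Qed.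
Lemma hom_addN : left_inverse hom_zero hom_opp hom_add.
Proof. by move=> f; apply: hom_ext => x; rewrite /hom_fun /= addNr. Qed.

HB.instance Definition _ :=
  GRing.isZmodule.Build Hom hom_addA hom_addC hom_add0 hom_addN.

Lemma scale_alg_linear (a : R) (f : Hom) : linear (fun x => a%:A *: hom_fun f x).
Proof.
move=> b x y; rewrite /hom_fun linearP scalerDr !scalerA.
by rewrite -scalerAl -scalerAr mul1r mulr1.
Qed.

Definition hom_scale (a : R) (f : Hom) : Hom :=
  HB.pack_for {linear U -> V} (fun x => a%:A *: hom_fun f x)
    (GRing.isLinear.Build A U V *:%R _ (scale_alg_linear a f)).

Lemma hom_scaleA a b f : hom_scale a (hom_scale b f) = hom_scale (a * b) f.
Proof.
apply: hom_ext => x; rewrite /hom_fun /= scalerA.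
by rewrite -scalerAl mul1r scalerA.
Qed.
Lemma hom_scale1 : left_id 1 hom_scale.
Proof. by move=> f; apply: hom_ext => x; rewrite /hom_fun /= !scale1r. Qed.
Lemma hom_scaleDr : right_distributive hom_scale +%R.
Proof. by move=> a f g; apply: hom_ext => x; rewrite /hom_fun /= scalerDr. Qed.
Lemma hom_scaleDl f : {morph hom_scale^~ f : a b / a + b}.
Proof. by move=> a b; apply: hom_ext => x; rewrite /hom_fun /= !scalerDl. Qed.

HB.instance Definition _ := GRing.Zmodule_isLmodule.Build R Hom
  hom_scaleA hom_scale1 hom_scaleDr hom_scaleDl.

End HomModule.

Section FreeLift.
Variables (A : nzRingType) (K : choiceType) (M : lmodType A) (f : K -> M).

Definition free_lift (D : {freeg K / A}) : M := fglift f D.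

HB.instance Definition _ :=
  GRing.isZmodMorphism.Build {freeg K / A} M free_lift (lift_is_additive f).

Lemma free_liftE D : free_lift D = \sum_(k <- dom D) coeff k D *: f k.
Proof.
rewrite -{1}(freeg_sumE D) raddf_sum; apply: eq_bigr => k _; exact: liftU.
Qed.

Lemma free_lift_scalable : scalable free_lift.
Proof.
move=> a D; have -> : a *: D = \sum_(k <- dom D) << a * coeff k D *g k >> by [].
rewrite raddf_sum /= free_liftE scaler_sumr.
apply: eq_bigr => k _; rewrite scalerA; exact: liftU.
Qed.

HB.instance Definition _ :=
  GRing.isScalable.Build A {freeg K / A} M *:%R free_lift free_lift_scalable.

End FreeLift.

Lemma free_projective (A : nzRingType) (K : choiceType) :
  projective ({freeg K / A} : lmodType A).
Proof.
move=> U V g f gs.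
pose s (k : K) : U := projT1 (cid (gs (f << k >>))).
have sE k : g (s k) = f << k >> by rewrite /s; case: cid.
exists (free_lift s : {linear _ -> _}) => D.
rewrite -[X in g X]/(free_lift s D) free_liftE -[in RHS](freeg_sumE D) !raddf_sum.
apply: eq_bigr => k _.
rewrite /= linearZ_LR sE -linearZ_LR; congr (f _).
by apply/eqP/freeg_eqP => x; rewrite coeffZ !coeffU mul1r.
Qed.


Record proj_resolution (A : nzRingType) (X : lmodType A) := ProjResolution {
  res_mod : nat -> lmodType A;
  res_d : forall n, {linear res_mod n.+1 -> res_mod n};
  res_aug : {linear res_mod 0 -> X};
  res_projective : forall n, projective (res_mod n);
  res_aug_surj : surj res_aug;
  res_exact0 : forall x, res_aug x = 0 <-> exists y, res_d 0 y = x;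
  res_exact : forall n x, res_d n x = 0 <-> exists y, res_d n.+1 y = x
}.

Section StandardResolution.
Variable A : nzRingType.

Section Kernel.
Variables (U V : lmodType A) (f : {linear U -> V}).

Definition lker_pred : {pred U} := fun x => f x == 0.

Lemma lker_closed : submod_closed lker_pred.
Proof.
split=> [|a x y]; rewrite !unfold_in ?linear0 // linearP.
by move=> /eqP-> /eqP->; rewrite scaler0 addr0.
Qed.

HB.instance Definition _ := GRing.isSubmodClosed.Build A U lker_pred lker_closed.

Record lker_mod := LkerMod { lker_val : U; _ : lker_val \in lker_pred }.

HB.instance Definition _ := [isSub for lker_val].
HB.instance Definition _ := [Choice of lker_mod by <:].
HB.instance Definition _ := [SubChoice_isSubLmodule of lker_mod by <:].

End Kernel.

(* The free resolution of X with terms A^(X), A^(K_1), A^(K_2), ..., where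
   K_(n+1) is the kernel of the canonical surjection A^(K_n) -> K_n. *)
Definition std_aug (K : lmodType A) : {linear {freeg K / A} -> K} :=
  free_lift id.

Fixpoint std_syz (X : lmodType A) (n : nat) : lmodType A :=
  if n is m.+1 then lker_mod (std_aug (std_syz X m)) else X.

Definition std_mod X n : lmodType A := {freeg (std_syz X n) / A}.

Definition std_d X n : {linear std_mod X n.+1 -> std_mod X n} :=
  (val : lker_mod (std_aug (std_syz X n)) -> _) \o std_aug (std_syz X n.+1).

Lemma std_aug_surj (K : lmodType A) : surj (std_aug K).
Proof.
move=> x; exists << x >>; rewrite -[LHS]/(fglift id _) liftU; exact: scale1r.
Qed.

Lemma std_exact (K : lmodType A) (x : {freeg K / A}) :
  std_aug K x = 0 <->
  exists y, val (std_aug (lker_mod (std_aug K)) y) = x.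
Proof.
split=> [x0|[y <-]]; last exact/eqP/(valP (std_aug _ y)).
have xK : x \in lker_pred (std_aug K) by apply/eqP.
by have [y yE] := std_aug_surj (LkerMod xK); exists y; rewrite yE.
Qed.

Lemma std_d_exact X n (x : std_mod X n.+1) :
  std_d X n x = 0 <-> exists y, std_d X n.+1 y = x.
Proof.
rewrite -(std_exact x) /=; split=> [x0|->]; last by [].
exact: val_inj.
Qed.

Definition std_resolution (X : lmodType A) : proj_resolution X :=
  @ProjResolution A X (std_mod X) (std_d X) (std_aug X)
    (fun n => @free_projective A (std_syz X n)) (@std_aug_surj X)
    (@std_exact X) (@std_d_exact X).

End StandardResolution.

Section Cohomology.
Variables (R : comNzRingType) (A : algType R) (X : lmodType A).
Variable P : proj_resolution X.
Implicit Types (W Y Z : lmodType A) (n : nat).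

Definition cocycle n Z : {pred Hom (res_mod P n) Z} :=
  fun f => `[< forall x, hom_fun f (res_d P n x) = 0 >].
Arguments cocycle : clear implicits.

Lemma cocycle_closed n Z : submod_closed (cocycle n Z).
Proof.
split=> [|a f g /asboolP f0 /asboolP g0]; apply/asboolP=> x //.
by rewrite [LHS]/(a%:A *: hom_fun f _ + hom_fun g _) f0 g0 scaler0; exact: addr0.
Qed.

HB.instance Definition _ n Z :=
  GRing.isSubmodClosed.Build R _ (cocycle n Z) (cocycle_closed n Z).

Record cocycle_mod n Z := CocycleMod {
  cocycle_val : Hom (res_mod P n) Z;
  _ : cocycle_val \in cocycle n Z
}.

HB.instance Definition _ n Z := [isSub for @cocycle_val n Z].
HB.instance Definition _ n Z := [Choice of cocycle_mod n Z by <:].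
HB.instance Definition _ n Z := [SubChoice_isSubLmodule of cocycle_mod n Z by <:].

Definition coboundary n Z : {pred cocycle_mod n Z} :=
  match n return {pred cocycle_mod n Z} with
  | 0 => fun f => f == 0
  | m.+1 => fun f => `[< exists g : Hom (res_mod P m) Z,
      forall x, hom_fun (val f) x = hom_fun g (res_d P m x) >]
  end.
Arguments coboundary : clear implicits.

Lemma coboundary_closed n Z : submod_closed (coboundary n Z).
Proof.
case: n => [|n]; split=> [|a f g].
- exact: eqxx.
- by move=> /eqP-> /eqP->; rewrite scaler0 addr0; exact: eqxx.
- by apply/asboolP; exists 0.
move=> /asboolP[f' fE] /asboolP[g' gE]; apply/asboolP; exists (a *: f' + g') => x.
rewrite [LHS]/(a%:A *: hom_fun (val f) x + hom_fun (val g) x) fE gE.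
by [].
Qed.

HB.instance Definition _ n Z :=
  GRing.isSubmodClosed.Build R _ (coboundary n Z) (coboundary_closed n Z).

Definition cohomology n Z : lmodType R := quot_mod (coboundary n Z).

Definition hom_post (U Y Z : lmodType A) (h : {linear Y -> Z}) (f : Hom U Y) :
  Hom U Z := (h \o (f : {linear U -> Y}) : {linear U -> Z})%FUN.

Lemma hom_post_cocycle n Y Z (h : {linear Y -> Z}) (f : Hom (res_mod P n) Y) :
  f \in cocycle n Y -> hom_post h f \in cocycle n Z.
Proof.
move=> /asboolP f0; apply/asboolP=> x.
rewrite [LHS]/(h (hom_fun f _)) f0; exact: linear0.
Qed.

Definition cocycle_map n Y Z (h : {linear Y -> Z}) (f : cocycle_mod n Y) :
  cocycle_mod n Z := CocycleMod (hom_post_cocycle h (valP f)).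

Lemma cocycle_map_linear n Y Z (h : {linear Y -> Z}) :
  linear (@cocycle_map n Y Z h).
Proof.
move=> a f g; apply/val_inj/hom_ext => x.
exact: (linearP h a%:A (hom_fun (val f) x) (hom_fun (val g) x)).
Qed.

HB.instance Definition _ n Y Z (h : {linear Y -> Z}) :=
  GRing.isLinear.Build R _ _ *:%R (@cocycle_map n Y Z h) (cocycle_map_linear h).

Lemma cocycle_map_coboundary n Y Z (h : {linear Y -> Z}) (f : cocycle_mod n Y) :
  f \in coboundary n Y -> cocycle_map h f \in coboundary n Z.
Proof.
case: n f => [|m] f; first by move=> /eqP->; rewrite linear0; exact: eqxx.
move=> /asboolP[g fE]; apply/asboolP; exists (hom_post h g) => x.
by rewrite [LHS]/(h (hom_fun (val f) x)) fE.
Qed.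

Definition cohomology_map n Y Z (h : {linear Y -> Z}) :
  {linear cohomology n Y -> cohomology n Z} :=
  quot_lmap (@cocycle_map_coboundary n Y Z h).

Lemma cohomology_mapE n Y Z (h : {linear Y -> Z}) (f : cocycle_mod n Y) :
  cohomology_map n h (quot_pi (coboundary n Y) f) =
  quot_pi (coboundary n Z) (cocycle_map h f).
Proof. exact: (quot_mapE (@cocycle_map_coboundary n Y Z h)). Qed.

Lemma cohomology_map_id n Z (q : cohomology n Z) :
  cohomology_map n (idfun : {linear Z -> Z}) q = q.
Proof.
have [f <-] := quot_pi_surj q; rewrite cohomology_mapE; congr quot_pi.
exact/val_inj/hom_ext.
Qed.

Lemma cohomology_map_comp n (W Y Z : lmodType A) (g : {linear Y -> Z}) (f : {linear W -> Y})
    (q : cohomology n W) :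
  cohomology_map n (g \o f : {linear W -> Z})%FUN q =
  cohomology_map n g (cohomology_map n f q).
Proof.
have [c <-] := quot_pi_surj q; rewrite !cohomology_mapE; congr quot_pi.
exact/val_inj/hom_ext.
Qed.

Lemma cohomology_map_lin n Y Z (a : R) (f g h : {linear Y -> Z}) :
  (forall y, h y = a%:A *: f y + g y) ->
  forall q, cohomology_map n h q = a *: cohomology_map n f q + cohomology_map n g q.
Proof.
move=> hE q; have [c <-] := quot_pi_surj q.
rewrite !cohomology_mapE -linearP; congr quot_pi.
by apply/val_inj/hom_ext => x; exact: (hE (hom_fun (val c) x)).
Qed.

Definition cohomology_functor n : rfunctor A :=
  @RFunctor R A (fun Z : modA A => cohomology n Z)
    (fun (U V : modA A) h => cohomology_map n h)
    (fun U : modA A => @cohomology_map_id n U)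
    (fun U V W : modA A => @cohomology_map_comp n U V W)
    (fun U V : modA A => @cohomology_map_lin n U V).

End Cohomology.

(* The d-th right derived functor of Hom_A(-, Z) at X, as a functor of Z. *)
Definition Ext (R : comNzRingType) (A : algType R) (d : nat) (X : lmodType A) :
  rfunctor A := cohomology_functor (std_resolution X) d.

Definition is_division (R : comNzRingType) (A : algType R) (d : nat)
    (M X Y : modA A) : Prop :=
  [/\ in_add M X /\ in_add M Y,
      forall Z : modA A, in_add X Z -> in_add Y Z -> trivial_module Z,
      ~ rfunctor_iso (Ext d X) (Ext d Y)
    & rfunctor_iso (Ext d.+1 X) (Ext d.+1 Y)].

Definition is_max (k : nat) (S : set nat) : Prop :=
  S k /\ forall m, S m -> (m <= k)%N.

(* Main.v *)
Require Import Defs.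
From HB Require Import structures.
From mathcomp Require Import all_boot order all_algebra generic_quotient ring_quotient.
From mathcomp Require Import boolp classical_sets.
From mathcomp.multinomials Require Import freeg.

(** The theorem translates isomorphism of Ext functors into equality in K(A).
    For n >= 0,

      Ext^(n+1)(X, -) and Ext^(n+1)(Y, -) are isomorphic
      if and only if Omega^n [X] = Omega^n [Y] in K(A)        (Ext_iso_iter).

    Granting this, let (X, Y) be a d-Division of M and x = [X] - [Y], an element
    of the subgroup <M>. Conditions (b) and (c) say that Omega^(d-1) x <> 0 and
    Omega^d x = 0, so Omega is not injective on Omega^(d-1) <M>, and d <= phi(M).
    Conversely every element of <M> is [X] - [Y] with X and Y in add(M), and
    splitting off common summands makes add(X) and add(Y) meet in 0
    (K_class_disjoint); so if phi(M) = d > 0, the failure of injectivity in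
    degree d-1 produces a d-Division. Since Omega maps Omega^n <M> onto
    Omega^(n+1) <M>, only injectivity is at stake, and phi(M) exists because the
    kernels of the powers of Omega on <M>, a finitely generated abelian group,
    form an ascending chain (syzygy_stable_exists).

    The equivalence rests on three facts about stable isomorphism, that is,
    isomorphism modulo maps that factor through projectives.

    - Classes in K(A) are equal exactly when the modules are stably isomorphic
      (stable_iso_K_class, K_class_stable_iso). The hard direction needs
      cancellation of common direct summands, which holds for modules of finite
      length because indecomposable ones have local endomorphism rings
      (cancel_fin_len).

    - Kernels of projective presentations of stably isomorphic modules are
      stably isomorphic (syzygy_stable_iso). Hence Omega is defined on K(A), and
      it can be computed from free presentations instead of projective covers.

    - The functor Ext^(n+1)(X, -) on mod(A) depends on, and determines, the
      stable isomorphism class of the n-th syzygy of X: one direction is the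
      comparison of resolutions (homotopic_cohomology_iso), the other is the
      argument of Hilton and Rees (cohomology_iso_stable).

    Finite length of finitely generated modules comes from the theorem of
    Hopkins that a commutative artinian ring has finite length (hopkins). *)

Set Implicit Arguments.
Unset Strict Implicit.
Unset Printing Implicit Defensive.

Import GRing.Theory.
Local Open Scope ring_scope.
Local Open Scope quotient_scope.
Local Open Scope classical_set_scope.

(** * Length of modules over artinian rings *)

Definition mklin (A : nzRingType) (U V : lmodType A) (h : U -> V)
    (hl : linear h) : {linear U -> V} :=
  HB.pack_for {linear U -> V} h (GRing.isLinear.Build A U V *:%R h hl).

Section Length.
Variables (B : nzRingType) (V : lmodType B).
Implicit Types S T U W : set V.

Definition submod W : Prop :=
  W 0 /\ forall a x y, W x -> W y -> W (a *: x + y).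

Lemma submodD W x y : submod W -> W x -> W y -> W (x + y).
Proof. by move=> [_ hW] Wx Wy; rewrite -[x]scale1r; exact: hW. Qed.

Lemma submodZ W a x : submod W -> W x -> W (a *: x).
Proof. by move=> [W0 hW] Wx; rewrite -[_ *: _]addr0; exact: hW. Qed.

Lemma submodB W x y : submod W -> W x -> W y -> W (x - y).
Proof. by move=> [_ hW] Wx Wy; rewrite addrC -scaleN1r; exact: hW. Qed.

Lemma submod0 : submod [set 0].
Proof. by split=> // a x y /= -> ->; rewrite scaler0 addr0. Qed.

Lemma submodI S T : submod S -> submod T -> submod (S `&` T).
Proof.
move=> [S0 hS] [T0 hT]; split=> // a x y [Sx Tx] [Sy Ty].
by split; [exact: hS | exact: hT].
Qed.

Definition add_set S T : set V := [set x | exists s t, [/\ S s, T t & x = s + t]].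

Lemma submod_add S T : submod S -> submod T -> submod (add_set S T).
Proof.
move=> [S0 hS] [T0 hT]; split=> [|a _ _ [s [t [Ss Tt ->]]] [s' [t' [Ss' Tt' ->]]]].
  by exists 0, 0; rewrite addr0.
exists (a *: s + s'), (a *: t + t'); split; [exact: hS | exact: hT |].
by rewrite scalerDr addrACA.
Qed.

(** Length of the interval between S and T in the lattice of submodules, as a
    bound on the number of strict steps of any chain. Counting the strict steps of
    chains that may stall makes additivity and transport direct, with no
    composition series to refine. *)
Definition len_le S T (n : nat) : Prop :=
  forall (C : nat -> set V) N, (forall i, submod (C i)) ->
    (forall i, C i `<=` C i.+1) -> (forall i, S `<=` C i) ->
    (forall i, C i `<=` T) ->
  (\sum_(i < N) `[< ~ (C i.+1 `<=` C i) >] <= n)%N.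

Lemma asbool_le_add (P Q Q' : Prop) :
  (P -> Q \/ Q') -> (`[< P >] <= `[< Q >] + `[< Q' >])%N.
Proof. by move=> h; case: (asboolP P) => // /h; do !case: asboolP => //; tauto. Qed.

Lemma modular_sub S C C' : submod C -> submod C' -> C `<=` C' ->
  C' `&` S `<=` C -> C' `<=` add_set C S -> C' `<=` C.
Proof.
move=> mC mC' CC' CS CaS x C'x; have [c [t [Cc St xE]]] := CaS x C'x.
rewrite xE; apply: submodD => //; apply: CS; split=> //.
by rewrite -(addKr c t) -xE addrC; apply: submodB => //; exact: CC'.
Qed.

(** By the modular law, a strict step of a chain between S and U remains strict
    after intersecting with T or after adding T. *)
Lemma len_le_trans S T U m n : submod T -> S `<=` T -> T `<=` U -> submod U ->
  len_le S T m -> len_le T U n -> len_le S U (m + n).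
Proof.
move=> mT ST TU mU lST lTU C N mC uC SC CU.
apply: leq_trans (leq_add (lST (fun i => C i `&` T) N _ _ _ _)
  (lTU (fun i => add_set (C i) T) N _ _ _ _)).
- rewrite -big_split /=; apply: leq_sum => i _; apply: asbool_le_add => ns.
  apply: contrapT => /not_orP[/contrapT sI /contrapT sA]; apply: ns.
  apply: (modular_sub (S := T)) => //.
    by move=> x Cx; exact: (sI _ Cx).1.
  by apply: subset_trans sA => x Cx; exists x, 0; rewrite addr0; case: mT.
- by move=> i; exact: submodI.
- by move=> i x [/uC].
- by move=> i x Sx; split; [exact: SC | exact: ST].
- by move=> i x [].
- by move=> i; exact: submod_add.
- by move=> i x [s [t [/uC]]]; exists s, t.
- by move=> i x Tx; exists 0, x; rewrite add0r; split=> //; case: (mC i).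
- by move=> i x [s [t [/CU Us /TU Ut ->]]]; exact: submodD.
Qed.

(** Every chain above S' can be lengthened by S at the bottom. *)
Lemma len_le_strict S S' T n : submod S -> submod S' -> S `<=` S' ->
  S' `<=` T -> ~ (S' `<=` S) ->
  len_le S T n -> exists2 m, n = m.+1 & len_le S' T m.
Proof.
move=> mS mS' SS' S'T nS l.
have key (C : nat -> set V) N : (forall i, submod (C i)) ->
    (forall i, C i `<=` C i.+1) -> (forall i, S' `<=` C i) ->
    (forall i, C i `<=` T) ->
    (\sum_(i < N) `[< ~ (C i.+1 `<=` C i) >] < n)%N.
  move=> mC uC SC CT.
  have := l (fun i => if i is j.+1 then C j else S) N.+1.
  rewrite big_ord_recl /=.
  have -> : `[< ~ (C 0%N `<=` S) >] by apply/asboolP => h; apply: nS; exact: subset_trans h.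
  rewrite add1n; apply.
  - by case.
  - by case=> //=; apply: subset_trans (SC _).
  - by case=> //= i; apply: subset_trans (SC _).
  - by case=> //=; exact: subset_trans S'T.
case: n l key => [|m] l key.
  by have := key (fun=> S') 0%N; rewrite ltn0 => h;
    have // : false by apply: h => // _; exact: subset_refl.
by exists m => // C N mC uC SC CT; rewrite -ltnS; exact: key.
Qed.

(** The first strict step of a chain already reaches T. *)
Lemma len_le_simple S T :
  (forall C, submod C -> S `<=` C -> C `<=` T -> C `<=` S \/ T `<=` C) ->
  len_le S T 1.
Proof.
move=> simple C N mC uC SC CT.
suff : (\sum_(i < N) `[< ~ (C i.+1 `<=` C i) >] <= `[< T `<=` C N >])%N.
  by move=> h; apply: leq_trans h _; case: asboolP.
elim: N => [|N IH]; first by rewrite big_ord0.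
rewrite big_ord_recr /=; case: (asboolP (~ (_ `<=` _))) => [ns|_].
  have nT : ~ T `<=` C N by move=> TC; apply: ns; exact: subset_trans TC.
  move: IH; rewrite asboolF // leqn0 => /eqP->.
  rewrite asboolT //; case: (simple (C N.+1)) => // CS.
  by case: ns; apply: subset_trans (SC _).
rewrite addn0; apply: leq_trans IH _.
case: (asboolP (T `<=` C N)) => // TC; rewrite asboolT //.
exact: subset_trans (uC _).
Qed.

Lemma len_le_refl S : len_le S S 0.
Proof.
move=> C N _ _ SC CS; rewrite big1 // => i _; rewrite asboolF //; apply.
exact: subset_trans (SC _).
Qed.

Lemma len_le_acc S T n (C : nat -> set V) : len_le S T n ->
  (forall i, submod (C i)) -> (forall i, C i `<=` C i.+1) ->
  (forall i, S `<=` C i) -> (forall i, C i `<=` T) ->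
  exists2 i, (i <= n)%N & C i.+1 `<=` C i.
Proof.
move=> l mC uC SC CT; apply: contrapT => h.
have := l C n.+1 mC uC SC CT.
rewrite (eq_bigr (fun=> 1%N)) => [|i _].
  by rewrite sum_nat_const card_ord muln1 ltnn.
by rewrite asboolT // => s; apply: h; exists i; rewrite // -ltnS.
Qed.

Lemma len_le_dcc S T n (C : nat -> set V) : len_le S T n ->
  (forall i, submod (C i)) -> (forall i, C i.+1 `<=` C i) ->
  (forall i, S `<=` C i) -> (forall i, C i `<=` T) ->
  exists2 i, (i <= n)%N & C i `<=` C i.+1.
Proof.
move=> l mC uC SC CT.
have [||||i le_in s] := @len_le_acc S T n (fun i => C (n.+1 - i)%N) l.
- by [].
- move=> i; case: (ltnP i n.+1) => [lt|le]; first by rewrite subSn.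
  have -> : (n.+1 - i.+1 = 0)%N by apply/eqP; rewrite subn_eq0 leqW.
  by have -> : (n.+1 - i = 0)%N by apply/eqP; rewrite subn_eq0.
- by [].
- by [].
by exists (n - i)%N; rewrite ?leq_subr // -subSn.
Qed.

End Length.

(** The two rings may differ: this is how left ideals of an R-algebra are compared
    with its R-submodules, and submodules generated by one more element with ideals. *)
Lemma len_le_map (B B' : nzRingType) (V : lmodType B) (V' : lmodType B')
    (Phi : set V -> set V') S T S' T' n :
  (forall C, submod C -> S `<=` C -> C `<=` T ->
     [/\ submod (Phi C), S' `<=` Phi C & Phi C `<=` T']) ->
  (forall C D, C `<=` D -> Phi C `<=` Phi D) ->
  (forall C D, submod C -> submod D -> S `<=` C -> D `<=` T -> C `<=` D ->
     Phi D `<=` Phi C -> D `<=` C) ->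
  len_le S' T' n -> len_le S T n.
Proof.
move=> Phi_sub Phi_mono Phi_refl l C N mC uC SC CT.
apply: leq_trans (l (fun i => Phi (C i)) N _ _ _ _).
- apply: leq_sum => i _; rewrite -[leqRHS]addn0.
  rewrite -[0%N]/(nat_of_bool false) -(asboolF (P := False)) //.
  apply: asbool_le_add => ns; left => s; apply: ns; exact: Phi_refl s.
- by move=> i; case: (Phi_sub (C i)).
- by move=> i; exact: Phi_mono.
- by move=> i; case: (Phi_sub (C i)).
- by move=> i; case: (Phi_sub (C i)).
Qed.

Definition fin_len (B : nzRingType) (V : lmodType B) (n : nat) : Prop :=
  @len_le B V [set 0] setT n.

Section FiniteLength.
Variable B : nzRingType.
Implicit Types U V : lmodType B.

Lemma fin_len_inj U V (f : {linear U -> V}) n :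
  injective f -> fin_len V n -> fin_len U n.
Proof.
move=> finj; apply: (len_le_map (Phi := fun C => f @` C)).
- move=> C [C0 mC] _ _; split=> [|x /= ->|//].
    split=> [|a _ _ [x Cx <-] [y Cy <-]]; first by exists 0; rewrite ?linear0.
    by exists (a *: x + y); [exact: mC | rewrite linearP].
  by exists 0; rewrite ?linear0.
- by move=> C D CD _ [x Cx <-]; exists x => //; exact: CD.
- move=> C D mC mD _ _ CD s x Dx; have [|y Cy /finj<-//] := s (f x).
  by exists x.
Qed.

(** Chains in U pull back to chains in U * V lying above V, which leaves room for
    0 below them. *)
Lemma fin_len_summand U V n : fin_len (U * V)%type n -> ~ trivial_module V ->
  exists2 m, n = m.+1 & fin_len U m.
Proof.
move=> l nV.
have [|||||m -> lm] := @len_le_strict B (U * V)%type [set 0] [set x | x.1 = 0] setT n _ _ _ _ _ l.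
- exact: submod0.
- by split=> // a x y /= -> ->; rewrite scaler0 addr0.
- by move=> x /= ->.
- by [].
- move=> h; apply: nV => v.
  by have /= [] := h (0, v) erefl.
exists m => //; move: lm.
apply: (len_le_map (Phi := fun C => [set x | C x.1])).
- move=> C [C0 mC] _ _; split=> // [|x /= ->//].
  by split=> // a x y /=; exact: mC.
- by move=> C D CD x; exact: CD.
- by move=> C D _ _ _ _ _ s x Dx; exact: (s (x, 0)).
Qed.

(** Each generator contributes at most the length of the regular module. *)
Lemma fin_gen_len V n : fin_len B^o n -> fin_gen V -> exists m, fin_len V m.
Proof.
move=> lB [k [s sV]].
pose T j : set V := [set x | exists c : 'I_k -> B, x = \sum_(i < k | (i < j)%N) c i *: s i].
have mT j : submod (T j).
  split=> [|a _ _ [c ->] [d ->]].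
    by exists (fun=> 0); rewrite big1 // => i _; rewrite scale0r.
  exists (fun i => a * c i + d i); rewrite scaler_sumr -big_split /=.
  by apply: eq_bigr => i _; rewrite scalerDl scalerA.
have T0 : T 0%N `<=` [set 0] by move=> x [c ->]; rewrite big_pred0.
have Tk : setT `<=` T k.
  by move=> x _; have [c ->] := sV x; exists c; apply: eq_bigl => i; rewrite ltn_ord.
have T0s j : [set 0] `<=` T j by move=> x ->; case: (mT j).
suff lT j : (j <= k)%N -> len_le [set 0] (T j) (j * n).
  exists (k * n)%N; have := lT k (leqnn k); rewrite /fin_len.
  by have -> : T k = setT by apply/seteqP.
elim: j => [_|j IH lt_jk].
  have -> : T 0%N = [set 0] by apply/seteqP; split.
  exact: len_le_refl.
rewrite mulSn addnC; apply: len_le_trans (mT j) _ _ _ (IH (ltnW lt_jk)) _ => //.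
  move=> x [c ->]; exists (fun i : 'I_k => if (i < j)%N then c i else 0).
  rewrite [RHS]big_mkcond [LHS]big_mkcond /=; apply: eq_bigr => i _.
  by rewrite ltnS; case: (ltnP i j) => [/ltnW->|_] //; rewrite scale0r if_same.
pose sj := s (Ordinal lt_jk).
move: lB; apply: (len_le_map (Phi := fun C => [set r : B^o | C (r *: sj)])).
- move=> C [C0 mC] _ _; split=> // [|x /= ->]; last by rewrite scale0r.
  split=> [/=|a x y /= Cx Cy]; first by rewrite scale0r.
  by rewrite scalerDl -scalerA; exact: mC.
- by move=> C D CD x; exact: CD.
- move=> C D mC mD TC DT CD h x Dx; have [c xE] := DT x Dx.
  have xE' : x = c (Ordinal lt_jk) *: sj + \sum_(i < k | (i < j)%N) c i *: s i.
    rewrite xE (bigD1 (Ordinal lt_jk)) //=; congr (_ + _).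
    by apply: eq_bigl => i; rewrite ltnS [RHS]ltn_neqAle andbC.
  have Tt : T j (\sum_(i < k | (i < j)%N) c i *: s i) by exists c.
  rewrite xE'; apply: submodD => //; last exact: TC.
  apply: h; rewrite /= -[_ *: _](addrK (\sum_(i < k | (i < j)%N) c i *: s i)) -xE'.
  by apply: submodB => //; apply/CD/TC.
Qed.

(** Adjoining an element from outside a submodule uses up one unit of length. *)
Lemma fin_len_gen V n : fin_len V n -> fin_gen V.
Proof.
have key m (S : set V) : submod S -> len_le S setT m ->
    exists k (s : 'I_k -> V), forall x, exists c, S (x - \sum_i c i *: s i).
  elim: m S => [|m IH] S mS lS; have [ST|/existsNP[x nSx]] := pselect (forall x, S x);
    try by exists 0%N, (fun=> 0) => x; exists (fun=> 0).
    have [||||//] := @len_le_strict _ _ S setT setT 0%N mS _ _ _ _ lS => // h.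
    by apply: nSx; exact: h.
  pose S' : set V := [set y | exists a, S (y - a *: x)].
  have mS' : submod S'.
    split=> [|a y z [b Sy] [c Sz]]; first by exists 0; rewrite scale0r subr0; case: mS.
    exists (a * b + c); rewrite scalerDl opprD addrACA -scalerA -scalerBr.
    by case: mS => _; exact.
  have SS' : S `<=` S' by move=> y Sy; exists 0; rewrite scale0r subr0.
  have nS' : ~ S' `<=` S.
    by move=> h; apply: nSx; apply: h; exists 1; rewrite scale1r subrr; case: mS.
  have [m' [<-] lS'] := len_le_strict mS mS' SS' (@subsetT _ _) nS' lS.
  have [k [s sE]] := IH _ mS' lS'.
  exists k.+1, (fun i => if unlift ord0 i is Some j then s j else x) => y.
  have [c [a Sa]] := sE y.
  exists (fun i => if unlift ord0 i is Some j then c j else a).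
  rewrite big_ord_recl unlift_none; under eq_bigr do rewrite liftK.
  by rewrite opprD addrA addrAC.
move=> /(key _ _ (submod0 V))[k [s sE]]; exists k, s => x.
by have [c /= /eqP] := sE x; rewrite subr_eq0 => /eqP; exists c.
Qed.

End FiniteLength.

Section Hopkins.
Variable R : comNzRingType.
Hypothesis artR : artinian R.
Implicit Types I J W : set R^o.

Lemma artinian_dcc (C : nat -> set R^o) : (forall i, submod (C i)) ->
  (forall i, C i.+1 `<=` C i) -> exists n, C n `<=` C n.+1.
Proof.
move=> mC dC; pose D i : {pred R^o} := fun x => `[< C i x >].
have [||n nP] := artR (I := D).
- move=> i; case: (mC i) => C0 hC; split=> [|a x y /asboolP Cx /asboolP Cy].
    exact/asboolP.
  by apply/asboolP; exact: hC.
- by move=> i x /asboolP Cx; apply/asboolP; exact: dC.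
by exists n => x /asboolP Cx; have := nP n.+1 (leqnSn n) x; move: Cx;
  rewrite !unfold_in /D => -> /asboolP.
Qed.

(** Otherwise dependent choice produces a strictly descending sequence. *)
Lemma artinian_min (F : set (set R^o)) : (forall I, F I -> submod I) ->
  F !=set0 -> exists2 I, F I & forall J, F J -> J `<=` I -> I `<=` J.
Proof.
move=> mF [I0 FI0]; apply: contrapT => nomin.
have step (I : {I | F I}) : {J : {I | F I} | sval J `<=` sval I /\ ~ sval I `<=` sval J}.
  apply: cid; apply: contrapT => h; apply: nomin; exists (sval I); first exact: svalP.
  move=> J FJ JI; apply: contrapT => nIJ; apply: h.
  by exists (exist _ J FJ).
pose C i := iter i (fun K => sval (step K)) (exist _ I0 FI0).
have [|i|n] := @artinian_dcc (fun i => sval (C i)).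
- by move=> i; apply: mF; exact: svalP.
- by rewrite /=; case: (svalP (step (C i))).
by rewrite /=; case: (svalP (step (C n))).
Qed.

(** Take an ideal I minimal among those of infinite length. Each scalar a either
    kills I or satisfies aI = I: otherwise aI and the kernel of a on I are both
    strictly smaller than I, hence of finite length, and so is I. In the second case
    the chain of the ideals generated by the powers of a shows that a is invertible
    on I, so I is a vector space over a field. A hyperplane of I has finite length
    by minimality, hence so has I, a contradiction. *)
Lemma hopkins : exists n, fin_len R^o n.
Proof.
apply: contrapT => ninf.
pose F I := submod I /\ ~ exists n, len_le [set 0] I n.
have [|I [mI nI] minI] := @artinian_min F (fun I => @proj1 _ _).
  by exists setT.
have small J : submod J -> J `<=` I -> ~ (I `<=` J) -> exists n, len_le [set 0] J n.
  by move=> mJ JI nIJ; apply: contrapT => nJ; apply: nIJ; exact: minI.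
have I0 : [set 0] `<=` I by move=> x ->; case: mI.
have dich (a : R) : (forall x, I x -> a * x = 0) \/
    (forall x, I x -> exists2 y, I y & a * y = x).
  apply: contrapT => /not_orP[nkill nonto].
  pose aI : set R^o := [set a * y | y in I].
  pose K : set R^o := [set x | I x /\ a * x = 0].
  have maI : submod aI.
    split=> [|b _ _ [x Ix <-] [y Iy <-]]; first by exists 0; [case: mI | rewrite mulr0].
    exists (b *: x + y); first by case: mI => _; exact.
    by rewrite mulrDr -[b *: x]/(b * x) mulrCA.
  have aII : aI `<=` I by move=> _ [x Ix <-]; exact: submodZ.
  have mK : submod K.
    split=> [|b x y [Ix x0] [Iy y0]]; first by split; [case: mI | rewrite mulr0].
    split; first by case: mI => _; exact.
    by rewrite mulrDr -[b *: x]/(b * x) mulrCA x0 y0 mulr0 addr0.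
  have KI : K `<=` I by move=> x [].
  have [m lm] : exists m, len_le [set 0] aI m by apply: small => // h; apply: nonto.
  have [m' lm'] : exists m', len_le [set 0] K m'.
    by apply: small => // h; apply: nkill => x /h[].
  apply: nI; exists (m' + m)%N; apply: (len_le_trans mK _ KI mI lm').
    by move=> x ->; case: mK.
  move: lm; apply: (len_le_map (V := R^o) (V' := R^o) (Phi := fun C => [set a * y | y in C])).
  - move=> C [C0 mC] KC CI; split=> [|x /= ->|_ [x Cx <-]]; last by exists x => //; exact: CI.
      split=> [|b _ _ [x Cx <-] [y Cy <-]]; first by exists 0; rewrite ?mulr0.
      exists (b *: x + y); first exact: mC.
      by rewrite mulrDr -[b *: x]/(b * x) mulrCA.
    by exists 0; rewrite ?mulr0.
  - by move=> C D CD _ [x Cx <-]; exists x => //; exact: CD.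
  - move=> C D mC mD KC DI CD s x Dx; have [|y Cy yE] := s (a * x); first by exists x.
    rewrite -(subrK y x); apply: submodD => //; apply: KC; split.
      by apply: DI; apply: (submodB (W := D)) => //; exact: CD.
    by rewrite mulrBr yE subrr.
(* a power r^n is a multiple of r^(n+1), and r^n maps I onto itself *)
have inv (r x0 : R) : I x0 -> r * x0 <> 0 -> exists s, forall x, I x -> s * (r * x) = x.
  move=> Ix0 rx0; have onto : forall x, I x -> exists2 y, I y & r * y = x.
    by case: (dich r) => // /(_ _ Ix0).
  have onto_n n x : I x -> exists2 y, I y & r ^+ n * y = x.
    elim: n x => [|n IH] x Ix; first by exists x; rewrite ?mul1r.
    have [y Iy <-] := onto x Ix; have [z Iz <-] := IH y Iy.
    by exists z => //; rewrite exprS mulrA.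
  have [||n] := @artinian_dcc (fun n => [set x | exists t : R, x = r ^+ n * t]).
  - move=> n; split=> [|b _ _ [t ->] [u ->]]; first by exists 0; rewrite mulr0.
    by exists (b * t + u); rewrite mulrDr mulrCA.
  - by move=> n _ [t ->]; exists (r * t); rewrite exprSr mulrA.
  move=> /(_ (r ^+ n)) [|t rE]; first by exists 1; rewrite mulr1.
  exists t => x Ix; have [y Iy <-] := onto_n n x Ix.
  by rewrite !mulrA -(mulrA t) -exprS mulrC [t * _]mulrC -rE mulrC.
have [v Iv v0] : exists2 v, I v & v <> 0.
  apply: contrapT => h; apply: nI; exists 0%N.
  suff -> : I = [set 0] by exact: len_le_refl.
  apply/seteqP; split=> // x Ix /=; apply: contrapT => x0; apply: h.
  by exists x.
(* the membership of 0 is left out so that the empty chain has an upper bound *)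
pose P W := [/\ forall a x y, W x -> W y -> W (a *: x + y), W `<=` I & ~ W v].
have [F' F'P F't|W [[hW WI nWv] Wmax]] := @Zorn_bigcup _ P.
  split=> [a x y [X F'X Xx] [Y F'Y Yy]|x [X /F'P[_ XI _] /XI]//|[X /F'P[_ _ h] /h]//].
  case: (F't X Y F'X F'Y) => h; [exists Y|exists X] => //.
    by have [hY _ _] := F'P Y F'Y; apply: hY => //; exact: h.
  by have [hX _ _] := F'P X F'X; apply: hX => //; exact: h.
have W0 : W 0.
  apply: contrapT => nW0; apply: (Wmax (W `|` [set 0])).
    by split=> [x Wx|h]; [left | apply: nW0; apply: h; right].
  split=> [a x y|x [/WI//|->]|[//|]]; last 2 first.
  - by case: mI.
  - by move=> /= v0'; apply: v0.
  move=> [Wx|->] [Wy|->]; rewrite ?scaler0 ?add0r; [left; exact: hW| |by left|by right].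
  by left; exfalso; apply: nW0; rewrite -(subrr x) addrC -scaleN1r; exact: hW.
have mW : submod W by [].
have [m lm] : exists m, len_le [set 0] W m by apply: small => // /(_ _ Iv).
apply: nI; exists (m + 1)%N; apply: (len_le_trans mW _ WI mI lm); first by move=> x ->.
apply: len_le_simple => C mC WC CI; apply: contrapT => /not_orP[nCW nIC].
have [u Cu nWu] : exists2 u, C u & ~ W u.
  by apply: contrapT => h; apply: nCW => u Cu; apply: contrapT => nWu; apply: h; exists u.
have gen (U : set R^o) : submod U -> U `<=` I -> W `<=` U -> (exists2 u, U u & ~ W u) -> U v.
  move=> [U0 hU] UI WU [x Ux nWx]; apply: contrapT => nUv.
  by apply: (Wmax U) => //; split=> // /(_ _ Ux).
have Cv : C v by apply: gen => //; exists u.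
apply: nIC => x Ix; have [Wx|nWx] := pselect (W x); first exact: WC.
have [w [a [Ww vE]]] : exists w a, W w /\ v = w + a * x.
  pose U : set R^o := [set y | exists w a, W w /\ y = w + a * x].
  apply: (gen U).
  - split=> [|b _ _ [w [a [Ww ->]]] [w' [a' [Ww' ->]]]].
      by exists 0, 0; rewrite mul0r addr0.
    exists (b *: w + w'), (b * a + a'); split; first exact: hW.
    by rewrite scalerDr addrACA mulrDl -[b *: (a * x)]/(b * (a * x)) mulrA.
  - by move=> _ [w [a [/WI Iw ->]]]; apply: submodD => //; exact: (submodZ (W := I)).
  - by move=> w Ww; exists w, 0; rewrite mul0r addr0.
  - by exists x => //; exists 0, 1; rewrite mul1r add0r.
have ax0 : a * x <> 0 by move=> ax0; apply: nWv; rewrite vE ax0 addr0.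
have [s sP] := inv a x Ix ax0.
rewrite -(sP x Ix); apply: (submodZ (W := C)) => //.
have -> : a * x = v - w by rewrite vE [w + _]addrC addrK.
by apply: submodB => //; exact: WC.
Qed.

End Hopkins.

(** Left ideals of A are R-submodules, so A has finite length as a left module over
    itself. *)
Lemma artin_fin_len (R : comNzRingType) (A : algType R) (V : lmodType A) :
  artin_algebra A -> fin_gen V -> exists n, fin_len V n.
Proof.
move=> [artR gA]; have [n lR] := hopkins artR.
have [m lA] := fin_gen_len lR gA; apply: (@fin_gen_len A V m).
move: lA; apply: (@len_le_map A R A^o (A : lmodType R) (fun C => C)) => //.
move=> C [C0 hC] _ _; split=> [|x /= ->|] //.
split=> // a x y Cx Cy; have := hC (a%:A : A) x y Cx Cy.
by rewrite -[(a%:A : A) *: (x : A^o)]/(a%:A * (x : A)) mulr_algl.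
Qed.

(** * Direct sums, local endomorphism rings and cancellation *)

Lemma inj_surj_bij (U V : Type) (f : U -> V) :
  injective f -> (forall v, exists u, f u = v) -> bijective f.
Proof.
move=> finj fsurj; pose g v := projT1 (cid (fsurj v)).
have fg v : f (g v) = v by rewrite /g; case: cid.
by exists g => [x|//]; apply: finj; rewrite fg.
Qed.

Section Isomorphisms.
Variable A : nzRingType.
Implicit Types S T U V W X Y Z : lmodType A.

Lemma bij_inverse U V (f : {linear U -> V}) : bijective f ->
  exists g : {linear V -> U}, cancel f g /\ cancel g f.
Proof.
move=> [g fK gK]; have gl : linear g.
  by move=> a x y; apply: (can_inj fK); rewrite linearP !gK.
by exists (mklin gl).
Qed.

Lemma isomorphicP U V : isomorphic U V <->
  exists (f : {linear U -> V}) (g : {linear V -> U}), cancel f g /\ cancel g f.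
Proof.
split=> [[f /bij_inverse[g fg]]|[f [g [fK gK]]]]; first by exists f, g.
by exists f; exists g.
Qed.

Lemma iso_intro U V (f : U -> V) (g : V -> U) :
  linear f -> cancel f g -> cancel g f -> isomorphic U V.
Proof. by move=> fl fK gK; exists (mklin fl); exists g. Qed.

Lemma pair_inl_linear U V : linear (fun x : U => (x, 0 : V)).
Proof. by move=> a x y; apply: injective_projections; rewrite //= scaler0 addr0. Qed.

Lemma pair_inr_linear U V : linear (fun y : V => (0 : U, y)).
Proof. by move=> a x y; apply: injective_projections; rewrite //= scaler0 addr0. Qed.

Lemma pair_fst_linear U V : linear (fun x : U * V => x.1).
Proof. by []. Qed.

Lemma pair_snd_linear U V : linear (fun x : U * V => x.2).
Proof. by []. Qed.

Definition pair_inl U V : {linear U -> (U * V)%type} := mklin (@pair_inl_linear U V).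
Definition pair_inr U V : {linear V -> (U * V)%type} := mklin (@pair_inr_linear U V).
Definition pair_fst U V : {linear (U * V)%type -> U} := mklin (@pair_fst_linear U V).
Definition pair_snd U V : {linear (U * V)%type -> V} := mklin (@pair_snd_linear U V).

Lemma linear_pair X Y Z (phi : {linear (X * Z)%type -> Y}) x z :
  phi (x, z) = phi (x, 0) + phi (0, z).
Proof.
rewrite -linearD; congr (phi _).
by apply: injective_projections; rewrite /= ?addr0 ?add0r.
Qed.

Lemma iso_refl U : isomorphic U U.
Proof. exact: (@iso_intro U U id id). Qed.

Lemma iso_sym U V : isomorphic U V -> isomorphic V U.
Proof. by move=> /isomorphicP[f [g [fK gK]]]; exists g; exists f. Qed.

Lemma iso_trans U V W : isomorphic U V -> isomorphic V W -> isomorphic U W.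
Proof.
move=> [f fb] [g gb]; exists (g \o f : {linear U -> W})%FUN.
exact: bij_comp.
Qed.

Lemma iso_prod U U' V V' : isomorphic U U' -> isomorphic V V' ->
  isomorphic (U * V)%type (U' * V')%type.
Proof.
move=> /isomorphicP[f [f' [fK f'K]]] /isomorphicP[g [g' [gK g'K]]].
apply: (@iso_intro _ _ (fun x => (f x.1, g x.2)) (fun x => (f' x.1, g' x.2))).
- by move=> a x y /=; rewrite !linearP.
- by move=> [x y]; rewrite /= fK gK.
- by move=> [x y]; rewrite /= f'K g'K.
Qed.

Lemma iso_prodC U V : isomorphic (U * V)%type (V * U)%type.
Proof. by apply: (@iso_intro _ _ (fun x => (x.2, x.1)) (fun x => (x.2, x.1))) => // -[]. Qed.

Lemma iso_prodA U V W :
  isomorphic (U * (V * W))%type (U * V * W)%type.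
Proof.
by apply: (@iso_intro _ _ (fun x => ((x.1, x.2.1), x.2.2))
  (fun x => (x.1.1, (x.1.2, x.2)))) => // [[x [y z]]|[[x y] z]].
Qed.

Lemma iso_prodACA U V W X :
  isomorphic (U * V * (W * X))%type (U * W * (V * X))%type.
Proof.
by apply: (@iso_intro _ _ (fun x => ((x.1.1, x.2.1), (x.1.2, x.2.2)))
  (fun x => ((x.1.1, x.2.1), (x.1.2, x.2.2)))) => // [[[x y] [z w]]|[[x y] [z w]]].
Qed.

Lemma iso_prod_trivial U T : trivial_module T -> isomorphic (U * T)%type U.
Proof.
move=> T0; apply: (@iso_intro _ _ (fun x => x.1) (fun x => (x, 0))) => // -[x y] /=.
by rewrite [y]T0.
Qed.

Lemma iso_trivial U V : isomorphic U V -> trivial_module U -> trivial_module V.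
Proof. by move=> [f [g fK gK]] U0 v; rewrite -[v]gK [g v]U0 linear0. Qed.

Lemma fin_len_iso U V n : isomorphic U V -> fin_len U n -> fin_len V n.
Proof. by move=> /iso_sym[f /bij_inj finj]; exact: fin_len_inj finj. Qed.

(** Direct summands as split monomorphisms with a retraction: such pairs compose,
    and no complement has to be named. *)
Definition retract W V : Prop :=
  exists (i : {linear W -> V}) (p : {linear V -> W}), cancel i p.

Lemma split_iso W V (i : {linear W -> V}) (p : {linear V -> W}) :
  cancel i p -> isomorphic V (W * lker_mod p)%type.
Proof.
move=> iK.
have kP x : x - i (p x) \in lker_pred p by apply/eqP; rewrite linearB iK subrr.
apply: (@iso_intro _ _ (fun x => (p x, LkerMod (kP x))) (fun x => i x.1 + val x.2)).
- move=> a x y; congr pair; first exact: linearP.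
  apply: val_inj; rewrite /= !linearP /=.
  by rewrite addrACA -scalerDr.
- by move=> x; rewrite /= addrC subrK.
- move=> [x k]; have pk : p (val k) = 0 by apply/eqP; exact: (valP k).
  congr pair; first by rewrite linearD iK pk addr0.
  by apply: val_inj; rewrite /= linearD iK pk addr0 addrC addKr.
Qed.

Lemma direct_summandP W V : direct_summand W V <-> retract W V.
Proof.
split=> [[W' /isomorphicP[f [g [fK gK]]]]|[i [p /split_iso iso]]]; last first.
  by exists (lker_mod p).
by exists (g \o pair_inl W W' : {linear W -> V})%FUN,
  (pair_fst W W' \o f : {linear V -> W})%FUN => x; rewrite /= gK.
Qed.

Lemma retract_trans U V W : retract U V -> retract V W -> retract U W.
Proof.
move=> [i [p iK]] [j [q jK]].
exists (j \o i : {linear U -> W})%FUN, (p \o q : {linear W -> U})%FUN => x /=.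
by rewrite jK iK.
Qed.

Lemma retract_iso U V : isomorphic U V -> retract U V.
Proof. by move=> /isomorphicP[f [g [fK gK]]]; exists f, g. Qed.

Lemma retract_prodl U V : retract U (U * V)%type.
Proof. by apply/direct_summandP; exists V; exact: iso_refl. Qed.

Lemma retract_prodr U V : retract V (U * V)%type.
Proof. by apply/direct_summandP; exists U; exact: iso_prodC. Qed.

Lemma indecomposable_retract U V : indecomposable V -> ~ trivial_module U ->
  retract U V -> isomorphic U V.
Proof.
move=> [_ iV] nU [i [p iK]]; have iso := split_iso iK.
have [//|k0] := iV _ _ iso.
exact: (iso_sym (iso_trans iso (iso_prod_trivial _ k0))).
Qed.

Lemma nontrivial_decomposes V : ~ trivial_module V -> ~ indecomposable V ->
  exists S T, [/\ isomorphic V (S * T)%type, ~ trivial_module S & ~ trivial_module T].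
Proof.
move=> nV dV; apply: contrapT => h; apply: dV; split=> // S T iso.
apply: contrapT => /not_orP[nS nT]; apply: h; by exists S, T.
Qed.

(** This stands in for the decomposition into indecomposables; it terminates since
    both terms of a nontrivial decomposition are shorter. *)
Lemma fin_len_ind (P : lmodType A -> Prop) :
  (forall V, trivial_module V -> P V) ->
  (forall V n, fin_len V n -> indecomposable V -> P V) ->
  (forall V S T, isomorphic V (S * T)%type -> P S -> P T -> P V) ->
  forall V n, fin_len V n -> P V.
Proof.
move=> P0 P1 P2 V n; elim/ltn_ind: n V => n IH V lV.
have [V0|nV] := pselect (trivial_module V); first exact: P0.
have [iV|dV] := pselect (indecomposable V); first exact: P1 lV iV.
have [S [T [iso nS nT]]] := nontrivial_decomposes nV dV.
have [m nE lS] := fin_len_summand (fin_len_iso iso lV) nT.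
have [m' nE' lT] := fin_len_summand
  (fin_len_iso (iso_trans iso (iso_prodC _ _)) lV) nS.
by apply: P2 iso _ _; [apply: IH lS; rewrite nE | apply: IH lT; rewrite nE'].
Qed.

End Isomorphisms.

Section Fitting.
Variables (A : nzRingType) (V : lmodType A) (n : nat).
Hypothesis lV : fin_len V n.
Implicit Types f g h : {linear V -> V}.

Lemma iter_linear f k : linear (iter k f).
Proof. by move=> a x y; elim: k => //= k ->; rewrite linearP. Qed.

(** The kernels and the images of the powers of f become stationary, so that V is
    the direct sum of the kernel and the image of a high power of f. The exponent is
    positive in order that f be bijective as soon as this power is. *)
Lemma fitting f : exists k, forall x,
  (iter k.+1 f (iter k.+1 f x) = 0 -> iter k.+1 f x = 0) /\
  exists y, iter k.+1 f (iter k.+1 f y) = iter k.+1 f x.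
Proof.
have iter0 k : iter k f 0 = 0 by elim: k => //= k ->; rewrite linear0.
have iterC k x : iter k f (f x) = f (iter k f x) by rewrite -iterSr.
have [|||//|i _ iP] := len_le_acc lV (C := fun k => [set x | iter k f x = 0]).
- move=> k; split=> [|a x y /= x0 y0]; first exact: iter0.
  by rewrite iter_linear x0 y0 scaler0 addr0.
- by move=> k x /= ->; rewrite linear0.
- by move=> k x ->; exact: iter0.
have [|||//|j _ jP] := len_le_dcc lV (C := fun k => range (iter k f)).
- move=> k; split=> [|a _ _ [x _ <-] [y _ <-]]; first by exists 0.
  by exists (a *: x + y); rewrite ?iter_linear.
- by move=> k _ [x _ <-]; exists (f x); rewrite // iterC.
- by move=> k x ->; exists 0.
have kerS k x : (i <= k)%N -> iter k.+1 f x = 0 -> iter k f x = 0.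
  move=> le_ik; rewrite -(subnKC le_ik) -addSn !iterD; exact: iP.
have kerD m k x : (i <= k)%N -> iter (m + k) f x = 0 -> iter k f x = 0.
  move=> le_ik; elim: m => // m IH h; apply: IH; apply: kerS h.
  exact: leq_trans (leq_addl _ _).
have imS k x : (j <= k)%N -> exists y, iter k.+1 f y = iter k f x.
  move=> le_jk; rewrite -(subnK le_jk) -addnS !iterD.
  have [|y _ yE] := jP (iter j f x); first by exists x.
  by exists y; rewrite iterD yE.
have imD m k x : (j <= k)%N -> exists y, iter (m + k) f y = iter k f x.
  move=> le_jk; elim: m x => [|m IH] x; first by exists x.
  have [y <-] := IH x; apply: imS; exact: leq_trans (leq_addl _ _).
exists (i + j)%N => x; rewrite -iterD; split.
  by apply: kerD; apply: leqW; exact: leq_addr.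
have [|y] := imD (i + j).+1 (i + j).+1 x; last by rewrite iterD; exists y.
by apply: leqW; exact: leq_addl.
Qed.

(** The projection onto the image of a high power of f along its kernel is an
    idempotent, hence 0 or 1. *)
Lemma indecomposable_endo f : indecomposable V ->
  bijective f \/ exists k, forall x, iter k f x = 0.
Proof.
move=> iV; have [k kP] := fitting f.
have [F FE] : exists F : {linear V -> V}, F =1 iter k.+1 f.
  by exists (mklin (iter_linear f k.+1)).
pose y x := projT1 (cid (kP x).2).
have yE x : F (F (y x)) = F x by rewrite !FE /y; case: cid.
have Finj x : F (F x) = 0 -> F x = 0 by rewrite !FE; exact: (kP x).1.
(* the projection onto the image of F along its kernel *)
pose e x := F (y x).
have Fe x : F (e x) = F x by exact: yE.
have eF z x : F (F z) = F x -> e x = F z.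
  move=> h; apply/eqP; rewrite -subr_eq0 -linearB; apply/eqP/Finj.
  by rewrite !linearB /= yE h subrr.
have el : linear e.
  move=> a x z; rewrite (eF (a *: y x + y z)); first exact: linearP.
  by rewrite (linearP F) (linearP F a (F (y x))) !yE (linearP F).
have eK z : e (F z) = F z by exact: eF.
have eI x : e (e x) = e x by exact: (eK (y x)).
pose E := mklin el; pose G : {linear V -> V} := (idfun \- E)%R.
have GE x : G (E x) = 0 by apply/eqP; rewrite subr_eq0; apply/eqP; rewrite /= eI.
have GP x : E x \in lker_pred G by apply/eqP.
have pl : linear (fun x => LkerMod (GP x)).
  by move=> a x z; apply: val_inj; exact: el.
have iK : cancel (val : lker_mod G -> V) (mklin pl).
  move=> x; apply: val_inj => /=; apply/esym/eqP; rewrite -subr_eq0.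
  exact: (valP x).
have [_ /(_ _ _ (split_iso iK))[W0|k0]] := iV.
  right; exists k.+1 => x; rewrite -FE -Fe.
  have -> : e x = 0 by have /(congr1 val) := W0 (LkerMod (GP x)).
  by rewrite linear0.
have eid x : e x = x.
  have h : x - e x \in lker_pred (mklin pl).
    by apply/eqP/val_inj; apply: etrans (linearB E x (e x)) _; rewrite /= eI subrr.
  have /(congr1 val)/= /eqP := k0 (LkerMod h).
  by rewrite subr_eq0 => /eqP.
left; apply: inj_surj_bij => [x z fxz|x].
  apply/eqP; rewrite -subr_eq0 -[x - z]eid; apply/eqP.
  have F0 : F (x - z) = 0.
    by rewrite FE iterSr linearB fxz subrr; elim: (k) => //= j ->; rewrite linear0.
  by rewrite (eF 0) ?linear0 // F0 linear0.
by exists (iter k f (y x)); rewrite -iterS -FE; exact: eid.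
Qed.

(** The endomorphism ring of V is local. If neither term were bijective, division
    by u would give two nilpotent endomorphisms with sum 1; but 1 minus a nilpotent
    endomorphism is injective, so V would be 0. *)
Lemma local_sum (f g u : {linear V -> V}) : indecomposable V -> bijective u ->
  (forall x, u x = f x + g x) -> bijective f \/ bijective g.
Proof.
move=> iV ub uE; have [v [uK vK]] := bij_inverse ub.
have [vf_b|[k vf_nil]] := indecomposable_endo (v \o f : {linear V -> V})%FUN iV.
  left; apply: (eq_bij (bij_comp ub vf_b)) => x /=; exact: vK.
have [vg_b|[m vg_nil]] := indecomposable_endo (v \o g : {linear V -> V})%FUN iV.
  right; apply: (eq_bij (bij_comp ub vg_b)) => x /=; exact: vK.
have vgE x : v (g x) = x - v (f x) by rewrite -[X in _ = X - _](uK x) uE linearD addrAC subrr add0r.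
have vg_inj : injective (iter m (v \o g)%FUN).
  elim: m {vg_nil} => [|m IH] x y //= /eqP; rewrite -subr_eq0 -!linearB => /eqP h.
  apply/IH/eqP; rewrite -subr_eq0; apply/eqP; move: h; rewrite vgE => /eqP.
  rewrite subr_eq0 => /eqP h; move: (_ - _) h => z zE.
  have zk j : z = iter j (v \o f)%FUN z by elim: j => //= j <-.
  by rewrite (zk k) vf_nil.
case: iV => nV _; case: nV => x; apply: vg_inj.
by rewrite !vg_nil.
Qed.

End Fitting.

Section Cancellation.
Variable A : nzRingType.
Implicit Types U V X Y Z W : lmodType A.

(** The identity of W is the sum of an endomorphism through U and one through V;
    one of the two is bijective. *)
Lemma retract_prod W n U V : fin_len W n -> indecomposable W ->
  retract W (U * V)%type -> retract W U \/ retract W V.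
Proof.
move=> lW iW [i [p iK]].
have [||/bij_inverse[h [fK _]]|/bij_inverse[h [fK _]]] := @local_sum A W n lW
    ((p \o pair_inl U V) \o (pair_fst U V \o i) : {linear W -> W})%FUN
    ((p \o pair_inr U V) \o (pair_snd U V \o i) : {linear W -> W})%FUN
    (idfun : {linear W -> W}) iW.
- by exists id.
- by move=> x; rewrite /= -linear_pair -surjective_pairing iK.
- by left; exists (pair_fst U V \o i : {linear W -> U})%FUN,
    (h \o (p \o pair_inl U V) : {linear U -> W})%FUN.
- by right; exists (pair_snd U V \o i : {linear W -> V})%FUN,
    (h \o (p \o pair_inr U V) : {linear V -> W})%FUN.
Qed.

(** Schur complement: an isomorphism whose corner at Z is invertible restricts to
    an isomorphism from the graph of x |-> - d^-1 (c x), where c is its corner from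
    X to Z, onto Y. *)
Lemma cancel_corner X Y Z (phi : {linear (X * Z)%type -> (Y * Z)%type})
    (d : {linear Z -> Z}) :
  bijective phi -> bijective d -> (forall z, d z = (phi (0, z)).2) ->
  isomorphic X Y.
Proof.
move=> /bij_inverse[psi [phiK psiK]] /bij_inverse[e [dK eK]] dE.
pose s x := - e (phi (x, 0)).2.
have sl : linear s.
  move=> a x y; rewrite /s scalerN -opprD -linearP; congr (- e _).
  by rewrite pair_inl_linear linearP.
have phis x : (phi (x, s x)).2 = 0.
  by rewrite linear_pair /= -dE linearN eK subrr.
have Fl : linear (fun x => (phi (x, s x)).1).
  move=> a x y; rewrite sl (_ : (a *: x + y, _) = a *: (x, s x) + (y, s y)) //.
  by rewrite linearP.
exists (mklin Fl); apply: inj_surj_bij => [x y /= Fxy|y].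
  have /(can_inj phiK)[] // : phi (x, s x) = phi (y, s y).
  by apply: injective_projections; rewrite // !phis.
have E := psiK (y, 0); case: (psi (y, 0)) E => x z E; exists x => /=.
suff -> : s x = z by rewrite E.
have /eqP : (phi (x, z)).2 = 0 by rewrite E.
rewrite linear_pair /= -dE addrC addr_eq0 => /eqP dzE.
by rewrite /s -linearN -dzE dK.
Qed.

(** Compare the corner d at Z of the isomorphism with the corner d' of its inverse:
    the identity of Z is the sum of d d' and of a map through X, and by locality one
    of the two is bijective. In the first case d is invertible, in the second it
    becomes so after composition with a shear. *)
Lemma cancel_indecomposable X Y Z n : fin_len Z n -> indecomposable Z ->
  isomorphic (X * Z)%type (Y * Z)%type -> isomorphic X Y.
Proof.
move=> lZ iZ /isomorphicP[phi [psi [phiK psiK]]].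
pose c : {linear X -> Z} := (pair_snd Y Z \o (phi \o pair_inl X Z))%FUN.
pose d : {linear Z -> Z} := (pair_snd Y Z \o (phi \o pair_inr X Z))%FUN.
pose b' : {linear Z -> X} := (pair_fst X Z \o (psi \o pair_inr Y Z))%FUN.
pose d' : {linear Z -> Z} := (pair_snd X Z \o (psi \o pair_inr Y Z))%FUN.
have sum z : z = c (b' z) + d (d' z).
  have E := psiK (0, z); rewrite /= ; case: (psi (0, z)) E => x z' E.
  by have := congr1 snd E; rewrite linear_pair /= => <-.
have phib : bijective phi by exists psi.
have nZ := proj1 iZ.
have [||cb|dd] := @local_sum A Z n lZ (c \o b' : {linear Z -> Z})%FUN
    (d \o d' : {linear Z -> Z})%FUN
    (idfun : {linear Z -> Z}) iZ; try by [|exists id].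
  have [db|nd] := pselect (bijective d).
    exact: (cancel_corner phib db).
  pose u : {linear Z -> Z} := (c \o b' : {linear Z -> Z})%FUN \+ d.
  have [|ub|[g gK hK]] := @local_sum A Z n lZ u (\- d)
      (c \o b' : {linear Z -> Z})%FUN iZ cb.
  - by move=> x; rewrite /= addrK.
  - (* shear X into Z along b' to make the corner at Z equal to u *)
    have shl : linear (fun x : X * Z => (x.1 + b' x.2, x.2)).
      move=> a x y; congr pair.
      rewrite -[LHS]/(a *: x.1 + y.1 + b' (a *: x.2 + y.2)) linearP.
      by rewrite -[RHS]/(a *: (x.1 + b' x.2) + (y.1 + b' y.2)) scalerDr addrACA.
    apply: (@cancel_corner _ _ Z (phi \o mklin shl : {linear _ -> _})%FUN u).
    + apply: bij_comp phib _; exists (fun x => (x.1 - b' x.2, x.2)) => -[x z].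
        by rewrite -[LHS]/(x + b' z - b' z, z) addrK.
      by rewrite -[LHS]/(x - b' z + b' z, z) subrK.
    + exact: ub.
    + by move=> z /=; rewrite add0r [in RHS]linear_pair.
  case: nd; exists (fun x => g (- x)) => x; first exact: gK.
  by apply: oppr_inj; exact: hK.
have [db|[k dnil]] := indecomposable_endo lZ d iZ.
  exact: (cancel_corner phib db).
case: nZ => z.
have dsurj y : exists x, d x = y.
  by case: dd => g _ gK; exists (psi (0, g y)).2; exact: gK.
have [x <-] : exists x, iter k d x = z.
  elim: k {dnil} => [|k [x <-]]; first by exists z.
  by have [y <-] := dsurj x; exists y; rewrite -iterSr.
exact: dnil.
Qed.

Lemma cancel_fin_len Z n : fin_len Z n -> forall X Y,
  isomorphic (X * Z)%type (Y * Z)%type -> isomorphic X Y.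
Proof.
move: Z n; apply: fin_len_ind => [Z Z0|Z n lZ iZ|Z S T iso IS IT] X Y h.
- apply: iso_trans (iso_sym (iso_prod_trivial X Z0)) _.
  exact: (iso_trans h (iso_prod_trivial _ Z0)).
- exact: cancel_indecomposable lZ iZ h.
- have e U : isomorphic (U * Z)%type (U * S * T)%type.
    exact: (iso_trans (iso_prod (iso_refl U) iso) (iso_prodA _ _ _)).
  by apply/IS/IT; exact: (iso_trans (iso_sym (e X)) (iso_trans h (e Y))).
Qed.

End Cancellation.

(** * Stable isomorphism and syzygies *)

Section FinitelyGenerated.
Variable A : nzRingType.
Implicit Types U V W : lmodType A.

Lemma fin_gen_surj U V (f : {linear U -> V}) : surj f -> fin_gen U -> fin_gen V.
Proof.
move=> fs [n [s sU]]; exists n, (f \o s) => v.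
have [u <-] := fs v; have [c ->] := sU u; exists c.
by rewrite linear_sum; apply: eq_bigr => i _; rewrite linearZ.
Qed.

Lemma fin_gen_retract U V : retract U V -> fin_gen V -> fin_gen U.
Proof.
by move=> [i [p iK]]; apply: (@fin_gen_surj _ _ p) => v; exists (i v).
Qed.

Lemma fin_gen_prod U V : fin_gen U -> fin_gen V -> fin_gen (U * V)%type.
Proof.
move=> [m [s sU]] [n [t tV]].
exists (m + n)%N, (fun i => match split i with inl j => (s j, 0) | inr j => (0, t j) end).
move=> [u v]; have [c ->] := sU u; have [d ->] := tV v.
exists (fun i => match split i with inl j => c j | inr j => d j end).
rewrite big_split_ord /=.
have el (j : 'I_m) : split (lshift n j) = inl j by exact: (unsplitK (inl j)).
have er (j : 'I_n) : split (rshift m j) = inr j by exact: (unsplitK (inr j)).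
under [X in _ = X + _]eq_bigr do rewrite el; under [X in _ = _ + X]eq_bigr do rewrite er.
apply: injective_projections; rewrite /= !raddf_sum /=.
  by rewrite [X in _ + X]big1 ?addr0 // => i _; rewrite scaler0.
by rewrite [X in X + _]big1 ?add0r // => i _; rewrite scaler0.
Qed.

Lemma fin_gen_cover V : fin_gen V ->
  exists n (f : {linear 'rV[A]_n -> V}), surj f.
Proof.
move=> [n [s sV]]; pose h (x : 'rV[A]_n) : V := \sum_i x 0 i *: s i.
have hl : linear h.
  move=> a x y; rewrite /h scaler_sumr -big_split /=.
  by apply: eq_bigr => i _; rewrite !mxE scalerDl scalerA.
exists n, (mklin hl) => y; have [c ->] := sV y; exists (\row_i c i).
by apply: eq_bigr => i _; rewrite mxE.
Qed.

Lemma fin_gen_row n : fin_gen 'rV[A]_n.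
Proof.
exists n, (fun i => delta_mx 0 i) => x; exists (fun i => x 0 i).
exact: row_sum_delta.
Qed.

Lemma row_projective n : projective 'rV[A]_n.
Proof.
move=> U V g f gs; pose s i := projT1 (cid (gs (f (delta_mx 0 i)))).
have sE i : g (s i) = f (delta_mx 0 i) by rewrite /s; case: cid.
have hl : linear (fun x : 'rV[A]_n => \sum_i x 0 i *: s i).
  move=> a x y; rewrite scaler_sumr -big_split /=.
  by apply: eq_bigr => i _; rewrite !mxE scalerDl scalerA.
exists (mklin hl) => x; rewrite /= [in RHS](row_sum_delta x) !linear_sum.
by apply: eq_bigr => i _; rewrite !linearZ sE.
Qed.

Lemma projective_retract U V : retract U V -> projective V -> projective U.
Proof.
move=> [i [p iK]] pV W X g f gs.
have [h hE] := pV W X g (f \o p : {linear V -> X})%FUN gs.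
by exists (h \o i : {linear U -> W})%FUN => x; rewrite /= hE /= iK.
Qed.

Lemma projective_trivial U : trivial_module U -> projective U.
Proof.
move=> U0 W X g f gs; exists (\0)%R => x.
by rewrite (U0 x) !linear0.
Qed.

Lemma projective_prod U V : projective U -> projective V -> projective (U * V)%type.
Proof.
move=> pU pV W X g f gs.
have [h1 h1E] := pU W X g (f \o pair_inl U V : {linear U -> X})%FUN gs.
have [h2 h2E] := pV W X g (f \o pair_inr U V : {linear V -> X})%FUN gs.
have hl : linear (fun x : U * V => h1 x.1 + h2 x.2).
  by move=> a x y /=; rewrite !linearP scalerDr addrACA.
exists (mklin hl) => -[u v] /=.
by rewrite linearD h1E h2E /= -linear_pair.
Qed.

Definition modA_prod (M N : modA A) : modA A :=
  ModA (fin_gen_prod (mod_fin_gen M) (mod_fin_gen N)).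

Definition modA_row n : modA A := ModA (fin_gen_row n).

End FinitelyGenerated.

Section StableIsomorphism.
Variable A : nzRingType.
Implicit Types N P T U V W : lmodType A.

Definition factors_proj U V (h : U -> V) : Prop :=
  exists P (s : {linear U -> P}) (t : {linear P -> V}),
    projective P /\ forall x, h x = t (s x).

(** Isomorphism in the category of modules modulo maps through projectives. *)
Definition stable_iso U V : Prop :=
  exists (f : {linear U -> V}) (g : {linear V -> U}),
    factors_proj (fun x => x - g (f x)) /\ factors_proj (fun y => y - f (g y)).

Lemma iso_proj_stable U V P Q : projective P -> projective Q ->
  isomorphic (U * P)%type (V * Q)%type -> stable_iso U V.
Proof.
move=> pP pQ /isomorphicP[phi [psi [phiK psiK]]].
have half (X Y P' Q' : lmodType A) (a : {linear (X * P')%type -> (Y * Q')%type})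
    (b : {linear (Y * Q')%type -> (X * P')%type}) x : cancel a b ->
    x - (b ((a (x, 0)).1, 0)).1 = (b (0, (a (x, 0)).2)).1.
  move=> aK; have := congr1 fst (aK (x, 0)); case: (a (x, 0)) => y q.
  by rewrite linear_pair /= => <-; rewrite addrAC subrr add0r.
exists (pair_fst V Q \o (phi \o pair_inl U P) : {linear U -> V})%FUN.
exists (pair_fst U P \o (psi \o pair_inl V Q) : {linear V -> U})%FUN.
split.
  exists Q, (pair_snd V Q \o (phi \o pair_inl U P) : {linear U -> Q})%FUN.
  exists (pair_fst U P \o (psi \o pair_inr V Q) : {linear Q -> U})%FUN.
  by split=> // x; exact: half.
exists P, (pair_snd U P \o (psi \o pair_inl V Q) : {linear V -> P})%FUN.
exists (pair_fst V Q \o (phi \o pair_inr U P) : {linear P -> V})%FUN.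
by split=> // x; exact: half.
Qed.

Definition proj_presentation N P U (i : {linear N -> P}) (p : {linear P -> U}) :=
  [/\ projective P, surj p, injective i & forall x, p x = 0 <-> exists y, i y = x].

Lemma exact_corestrict N P U T (i : {linear N -> P}) (p : {linear P -> U})
    (h : {linear T -> P}) :
  injective i -> (forall x, p x = 0 <-> exists y, i y = x) ->
  (forall x, p (h x) = 0) ->
  exists k : {linear T -> N}, forall x, i (k x) = h x.
Proof.
move=> iinj ex ph; have e x : exists y, i y = h x by apply/ex.
pose k x := projT1 (cid (e x)).
have kE x : i (k x) = h x by rewrite /k; case: cid.
have kl : linear k by move=> a x y; apply: iinj; rewrite linearP !kE linearP.
by exists (mklin kl).
Qed.

Lemma presentation_lift N P U N' P' U' (i : {linear N -> P}) (p : {linear P -> U})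
    (i' : {linear N' -> P'}) (p' : {linear P' -> U'}) (f : {linear U -> U'}) :
  proj_presentation i p -> proj_presentation i' p' ->
  exists (F : {linear P -> P'}) (k : {linear N -> N'}),
    (forall x, p' (F x) = f (p x)) /\ (forall x, i' (k x) = F (i x)).
Proof.
move=> [pP ps iinj ex] [pP' ps' i'inj ex'].
have [F FE] := pP P' U' p' (f \o p : {linear P -> U'})%FUN ps'.
have [x|k kE] := exact_corestrict (h := (F \o i : {linear N -> P'})%FUN) i'inj ex'.
  rewrite /= FE /= (_ : p (i x) = 0) ?linear0 //; apply/ex; by exists x.
by exists F, k.
Qed.

(** If h is a composite U -> T -> U with T projective, lift T -> U to T -> P and
    subtract from E the composite P -> U -> T -> P. The result lands in N, and it
    agrees with E on N, so there the map e extends to P. *)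
Lemma presentation_factors N P U (i : {linear N -> P}) (p : {linear P -> U})
    (e : {linear N -> N}) (E : {linear P -> P}) (h : U -> U) :
  proj_presentation i p -> (forall x, i (e x) = E (i x)) ->
  (forall x, p (E x) = h (p x)) -> factors_proj h -> factors_proj e.
Proof.
move=> [pP ps iinj ex] eE Eh [T [s [t [pT ts]]]].
have [t' t'E] := pT _ _ p t ps.
have [x|r rE] := exact_corestrict (h := (E \- (t' \o (s \o p)) : {linear P -> P})%FUN) iinj ex.
  by rewrite linearB /= t'E -ts Eh subrr.
exists P, i, r; split=> // x; apply: iinj; rewrite rE eE /=.
have -> : p (i x) = 0 by apply/ex; exists x.
by rewrite !linear0 addr0.
Qed.

(** Lift a stable isomorphism and its inverse to the presentations and apply
    presentation_factors to the identity minus the two composites. *)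
Lemma syzygy_stable_iso N P U N' P' U' (i : {linear N -> P}) (p : {linear P -> U})
    (i' : {linear N' -> P'}) (p' : {linear P' -> U'}) :
  proj_presentation i p -> proj_presentation i' p' ->
  stable_iso U U' -> stable_iso N N'.
Proof.
move=> pr pr' [f [g [gf fg]]].
have [F [f' [FE f'E]]] := presentation_lift f pr pr'.
have [G [g' [GE g'E]]] := presentation_lift g pr' pr.
exists f', g'; split.
  apply: (@presentation_factors N P U i p (idfun \- (g' \o f'))%FUN
    (idfun \- (G \o F))%FUN) pr _ _ gf => x; rewrite linearB /=.
  - by rewrite g'E f'E.
  - by rewrite GE FE.
apply: (@presentation_factors N' P' U' i' p' (idfun \- (f' \o g'))%FUN
  (idfun \- (F \o G))%FUN) pr' _ _ fg => x; rewrite linearB /=.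
- by rewrite f'E g'E.
- by rewrite FE GE.
Qed.

(** Adding a free cover F of U turns the stable isomorphism f into a split
    monomorphism from U to V * F. The identity of its complement factors through a
    projective, so the complement is projective. *)
Lemma stable_iso_summands U V : fin_gen U -> fin_gen V -> stable_iso U V ->
  exists P Q : modA A, [/\ projective P, projective Q &
    isomorphic (U * P)%type (V * Q)%type].
Proof.
move=> gU gV [f [g [[T [s [t [pT ts]]]] [T' [s' [t' [pT' ts']]]]]]].
have [n [c cs]] := fin_gen_cover gU.
have [t2 t2E] := pT _ _ c t cs.
pose F := 'rV[A]_n.
have sl : linear (fun u => (f u, t2 (s u)) : V * F).
  by move=> a x y; rewrite !linearP.
have rl : linear (fun x : V * F => g x.1 + c x.2).
  by move=> a x y /=; rewrite !linearP scalerDr addrACA.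
pose sigma := mklin sl; pose rho := mklin rl.
have rhoK : cancel sigma rho.
  by move=> x; rewrite /= t2E -ts addrC subrK.
have vinj : injective (val : lker_mod rho -> _) by exact: val_inj.
have ex x : rho x = 0 <-> exists y : lker_mod rho, val y = x.
  split=> [x0|[y <-]]; last by apply/eqP; exact: (valP y).
  have xK : x \in lker_pred rho by apply/eqP.
  by exists (LkerMod xK).
have [x|pi piE] := exact_corestrict
    (h := (idfun \- (sigma \o rho))%FUN : {linear (V * F)%type -> (V * F)%type}) vinj ex.
  apply: etrans (linearB rho x (sigma (rho x))) _; apply/eqP; rewrite subr_eq0 eq_sym.
  exact/eqP/rhoK.
have piK : cancel (val : lker_mod rho -> _) pi.
  move=> k; apply: vinj; rewrite piE -[LHS]/(val k - sigma (rho (val k))).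
  have -> : rho (val k) = 0 by apply/ex; exists k.
  by rewrite linear0 subr0.
have gK : fin_gen (lker_mod rho).
  apply: (@fin_gen_retract A _ (V * F)%type); first by exists val, pi.
  exact: fin_gen_prod gV (fin_gen_row _ _).
have al : linear (fun k : lker_mod rho => (s' (val k).1, (val k).2) : T' * F).
  by move=> a x y; rewrite !linearP.
have bl : linear (fun x : T' * F => (t' x.1 - f (c x.2), x.2) : V * F).
  move=> a x y /=; rewrite !linearP /=; congr pair.
  by rewrite addrACA -scalerDr.
exists (ModA gK), (modA_row A n); split; last first.
- exact: (iso_sym (split_iso rhoK)).
- exact: row_projective.
apply: (@projective_retract A _ (T' * F)%type); last first.
  by apply: projective_prod => //; exact: row_projective.
(* on the complement, c a = - g v, so the first coordinate is v *)
have key x : rho x = 0 -> mklin bl (s' x.1, x.2) = x.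
  case: x => v a; rewrite /= addrC => /eqP; rewrite addr_eq0 => /eqP->.
  by rewrite -ts' linearN opprK subrK.
exists (mklin al), (pi \o mklin bl : {linear (T' * F)%type -> lker_mod rho})%FUN => k.
apply: etrans (congr1 pi (key _ _)) (piK k); apply/ex; by exists k.
Qed.

End StableIsomorphism.

(** * Classes in K(A) are stable isomorphism classes *)

Section KGroup.
Variable A : nzRingType.
Implicit Types M N P S T X Y : modA A.

Let rel := gen_subgroup (@K_relation A).

Definition K_pi : K_free A -> K_group A := \pi_(Quotient.quot rel).

Lemma K_pi_additive : zmod_morphism K_pi.
Proof. exact: (@raddfB _ _ (\pi_(Quotient.quot rel) : {additive K_free A -> _})). Qed.

HB.instance Definition _ :=
  GRing.isZmodMorphism.Build (K_free A) (K_group A) K_pi K_pi_additive.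

Lemma K_pi_eq0 (D : K_free A) : K_pi D = 0 <-> D \in rel.
Proof.
rewrite -[D in D \in _]subr0 Quotient.idealrBE; split=> [h|/eqP h].
  by apply/eqP; rewrite -[LHS]/(K_pi D) h; exact: esym (raddf0 K_pi).
by rewrite -(raddf0 K_pi); exact: h.
Qed.

Lemma K_relation_eq0 D : K_relation D -> K_pi D = 0.
Proof. by move=> rD; apply/K_pi_eq0/asboolP => U _; apply. Qed.

Lemma K_class_iso X Y : isomorphic X Y -> K_class X = K_class Y.
Proof. by move=> /iso_classP e; rewrite /K_class e. Qed.

Lemma K_class_prod N S T : isomorphic N (S * T)%type ->
  K_class N = K_class S + K_class T.
Proof.
move=> iso.
have := @K_relation_eq0 _
  (or_introl (ex_intro _ N (ex_intro _ S (ex_intro _ T (conj iso erefl))))).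
by rewrite !raddfB /= -addrA -opprD => /eqP; rewrite subr_eq0 => /eqP.
Qed.

Lemma K_class_projective P : projective P -> K_class P = 0.
Proof.
by move=> pP; exact: (@K_relation_eq0 _ (or_intror (ex_intro2 _ _ P pP erefl))).
Qed.

Lemma stable_iso_K_class X Y : stable_iso X Y -> K_class X = K_class Y.
Proof.
move=> /(stable_iso_summands (mod_fin_gen X) (mod_fin_gen Y)) [P [Q [pP pQ iso]]].
have eX := K_class_prod (N := modA_prod X P) (iso_refl _).
have eY := K_class_prod (N := modA_prod X P) iso.
by move: eX; rewrite eY (K_class_projective pP) (K_class_projective pQ) !addr0.
Qed.

Lemma K_pi_surj (x : K_group A) : exists D, K_pi D = x.
Proof. by exists (repr x); rewrite /K_pi reprK. Qed.

(** The linear extension of F to the free group vanishes on the relation subgroup. *)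
Lemma K_group_lift (F : isoclass A -> K_group A) :
  (forall N S T, isomorphic N (S * T)%type ->
     F (iso_class N) = F (iso_class S) + F (iso_class T)) ->
  (forall P, projective P -> F (iso_class P) = 0) ->
  exists Om : {additive K_group A -> K_group A},
    forall M, Om (K_class M) = F (iso_class M).
Proof.
move=> Fadd Fproj.
pose L (D : K_free A) : K_group A := fglift (F : isoclass A -> zmodule (K_group A)) D.
have LB D D' : L (D - D') = L D - L D'.
  exact: (lift_is_additive (F : isoclass A -> zmodule (K_group A)) D D').
have L1 c : L << c >> = F c by rewrite /L liftU scale1r.
have L0 D : D \in rel -> L D = 0.
  move=> /asboolP h; have /eqP // : D \in [pred D | L D == 0].
  apply: h => [|_ [[N [S [T [iso ->]]]]|[P pP ->]]].
  - split=> [|D1 D2]; rewrite !inE.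
      by apply/eqP; rewrite -[X in L X](subrr 0) LB subrr.
    by move=> /eqP D1E /eqP D2E; rewrite LB D1E D2E subrr.
  - by rewrite inE !LB !L1 (Fadd _ _ _ iso) -addrA -opprD subrr.
  - by rewrite inE L1 Fproj.
pose om (q : K_group A) := L (repr q).
have omE D : om (K_pi D) = L D.
  apply/eqP; rewrite -subr_eq0 -LB; apply/eqP/L0/K_pi_eq0.
  by rewrite raddfB /= {1}/K_pi reprK subrr.
have oml : zmod_morphism om.
  move=> x y; have [D <-] := K_pi_surj x; have [D' <-] := K_pi_surj y.
  by rewrite -raddfB !omE LB.
exists (HB.pack_for {additive K_group A -> K_group A} om
  (GRing.isZmodMorphism.Build _ _ om oml)) => M.
exact: etrans (omE _) (L1 _).
Qed.

Lemma iso_class_rep (c : isoclass A) : {M : modA A | iso_class M = c}.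
Proof.
apply: cid; case: c => c [M cE]; exists M; exact: eq_exist.
Qed.

Definition isoclass_rep (c : isoclass A) : modA A := sval (iso_class_rep c).

Lemma isoclass_repK c : iso_class (isoclass_rep c) = c.
Proof. exact: (svalP (iso_class_rep c)). Qed.

Lemma isoclass_rep_iso M : isomorphic (isoclass_rep (iso_class M)) M.
Proof. by apply/iso_classP; exact: isoclass_repK. Qed.

Definition zero_mod : modA A := modA_row A 0.

Lemma zero_mod_trivial : trivial_module zero_mod.
Proof. by move=> x; apply/rowP; case. Qed.

Definition dsum (s : seq (isoclass A)) : modA A :=
  foldr (fun c M => modA_prod (isoclass_rep c) M) zero_mod s.

Lemma dsum1 M : isomorphic (dsum [:: iso_class M]) M.
Proof. exact: (iso_trans (iso_prod_trivial _ zero_mod_trivial) (isoclass_rep_iso M)). Qed.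

Lemma dsum_cat s t : isomorphic (dsum (s ++ t)) (dsum s * dsum t)%type.
Proof.
elim: s => [|c s IH] /=.
  apply: iso_trans (iso_prodC _ _); apply: iso_sym.
  exact: iso_prod_trivial zero_mod_trivial.
exact: (iso_trans (iso_prod (iso_refl _) IH) (iso_prodA _ _ _)).
Qed.

Lemma dsum_perm s t : perm_eq s t -> isomorphic (dsum s) (dsum t).
Proof.
move=> st; pose P u := isomorphic (dsum s) (dsum u).
apply: (@catCA_perm_ind _ P _ s t st (iso_refl _)) => {st t} s1 s2 s3 h.
have swap u v w : isomorphic (dsum (u ++ v ++ w)) (dsum u * dsum v * dsum w)%type.
  apply: iso_trans (dsum_cat _ _) _; apply: iso_trans (iso_prodA _ _ _).
  exact: iso_prod (iso_refl _) (dsum_cat _ _).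
apply: iso_trans h _; apply: iso_trans (swap _ _ _) _.
apply: iso_trans _ (iso_sym (swap _ _ _)).
exact: iso_prod (iso_prodC _ _) (iso_refl _).
Qed.

Definition cycle_sum (s : seq (isoclass A)) : K_free A := \sum_(c <- s) << c >>.

Lemma cycle_sum_cat s t : cycle_sum (s ++ t) = cycle_sum s + cycle_sum t.
Proof. exact: big_cat. Qed.

Lemma cycle_sum_inj s t : cycle_sum s = cycle_sum t -> perm_eq s t.
Proof.
have cnt u x : coeff x (cycle_sum u) = (count_mem x u)%:R.
  rewrite /cycle_sum raddf_sum /= -sum1_count natr_sum [RHS]big_mkcond.
  apply: eq_bigr => c _; rewrite coeffU mul1r /=.
  by case: (c == x).
move=> e; apply/allP => x _ /=; rewrite -(Num.Theory.eqr_nat int).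
by rewrite -!cnt e.
Qed.

End KGroup.

Section Krull.
Variables (A : nzRingType) (nA : nat).
Hypothesis lA : fin_len A^o nA.
Implicit Types M N P S T X Y : modA A.

Lemma modA_len M : exists n, fin_len M n.
Proof. exact: fin_gen_len lA (mod_fin_gen M). Qed.

Lemma modA_cancel X Y M : isomorphic (X * M)%type (Y * M)%type -> isomorphic X Y.
Proof. by have [n lM] := modA_len M; exact: (cancel_fin_len lM). Qed.

(** Every element of the relation subgroup is a difference of two formal sums whose
    direct sums become isomorphic after adding projectives. Comparing such an
    expression with [X] - [Y] in the free group shows that X and Y become isomorphic
    after adding projectives and a common summand, and the latter cancels. *)
Lemma K_class_stable_iso X Y : K_class X = K_class Y -> stable_iso X Y.
Proof.
move=> e; pose good (D : K_free A) := exists s t (P Q : modA A),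
  [/\ D = cycle_sum s - cycle_sum t, projective P, projective Q
    & isomorphic (dsum s * P)%type (dsum t * Q)%type].
have z0 : projective (zero_mod A) := projective_trivial (@zero_mod_trivial A).
have [s [t [P [Q [E pP pQ iso]]]]] : good (<< iso_class X >> - << iso_class Y >>).
  have /asboolP h : << iso_class X >> - << iso_class Y >> \in gen_subgroup (@K_relation A).
    by apply/K_pi_eq0; rewrite raddfB /=; apply/eqP; rewrite subr_eq0; apply/eqP.
  apply/asboolP; apply: (h (fun D => `[< good D >])).
  - split=> [|D D' /asboolP[s [t [P [Q [-> pP pQ iso]]]]]
      /asboolP[s' [t' [P' [Q' [-> pP' pQ' iso']]]]]]; apply/asboolP.
      exists [::], [::], (zero_mod A), (zero_mod A).
      by split; rewrite ?subrr //; exact: iso_refl.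
    exists (s ++ t'), (t ++ s'), (modA_prod P Q'), (modA_prod Q P').
    split; [|exact: projective_prod|exact: projective_prod|].
      by rewrite !cycle_sum_cat opprB addrACA opprD.
    have cat_iso u v (V W : modA A) : isomorphic (dsum (u ++ v) * (V * W))%type
        ((dsum u * V) * (dsum v * W))%type.
      exact: (iso_trans (iso_prod (dsum_cat _ _) (iso_refl _)) (iso_prodACA _ _ _ _)).
    apply: iso_trans (cat_iso _ _ _ _) _; apply: iso_trans _ (iso_sym (cat_iso _ _ _ _)).
    exact: (iso_prod iso (iso_sym iso')).
  - move=> _ [[N [S [T [iso ->]]]]|[P pP ->]]; apply/asboolP.
      exists [:: iso_class N], [:: iso_class S; iso_class T], (zero_mod A), (zero_mod A).
      split=> //; first by rewrite /cycle_sum !big_cons big_nil !addr0 opprD addrA.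
      apply: iso_prod (iso_refl _); apply: iso_trans (dsum1 _) _.
      apply: iso_trans iso _; apply: iso_sym.
      exact: (iso_prod (isoclass_rep_iso _) (dsum1 _)).
    exists [:: iso_class P], [::], (zero_mod A), P.
    split=> //; first by rewrite /cycle_sum big_seq1 big_nil subr0.
    by apply: iso_trans (iso_prodC _ _) _; apply: iso_prod (iso_refl _) (dsum1 _).
have : cycle_sum (iso_class X :: t) = cycle_sum (iso_class Y :: s).
  rewrite /cycle_sum !big_cons; apply/eqP.
  by rewrite -subr_eq0 opprD addrACA E /cycle_sum addrA subrK subrr.
move=> /cycle_sum_inj/dsum_perm h.
have {}h : isomorphic (X * dsum t)%type (Y * dsum s)%type.
  apply: iso_trans (iso_sym (iso_prod (isoclass_rep_iso X) (iso_refl _))) _.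
  exact: (iso_trans h (iso_prod (isoclass_rep_iso Y) (iso_refl _))).
have := iso_prod h iso => {h iso} h.
apply: (iso_proj_stable pP pQ).
apply: (@modA_cancel (modA_prod X P) (modA_prod Y Q) (modA_prod (dsum t) (dsum s))).
apply: iso_trans (iso_sym (iso_prodACA _ _ _ _)) _.
apply: iso_trans (iso_prod (iso_refl _) (iso_prodC _ _)) _.
apply: iso_trans h _.
apply: iso_trans (iso_prod (iso_refl _) (iso_prodC _ _)) _.
apply: iso_trans (iso_prodACA _ _ _ _) _.
exact: iso_prod (iso_refl _) (iso_prodC _ _).
Qed.

End Krull.

(** * The endomorphism of K(A) induced by syzygies *)

Section Presentations.
Variable A : nzRingType.
Implicit Types K N P T U V W : lmodType A.

Lemma ker_val_exact U V (f : {linear U -> V}) x :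
  f x = 0 <-> exists y : lker_mod f, val y = x.
Proof.
split=> [x0|[y <-]]; last by apply/eqP; exact: (valP y).
have xK : x \in lker_pred f by apply/eqP.
by exists (LkerMod xK).
Qed.

Lemma coker_factor U V W (p : {linear U -> V}) (m : {linear U -> W}) :
  surj p -> (forall x, p x = 0 -> m x = 0) ->
  exists s : {linear V -> W}, forall x, s (p x) = m x.
Proof.
move=> ps pm; pose q v := projT1 (cid (ps v)).
have qK v : p (q v) = v by rewrite /q; case: cid.
have mE x y : p x = p y -> m x = m y.
  move=> /eqP; rewrite -subr_eq0 -linearB => /eqP/pm/eqP.
  by rewrite linearB subr_eq0 => /eqP.
have sl : linear (fun v => m (q v)).
  by move=> a x y; rewrite -linearP; apply: mE; rewrite linearP !qK.
by exists (mklin sl) => x; apply: mE; rewrite qK.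
Qed.

(** The pullback of d and h maps onto T, so it has a section. *)
Lemma projective_lift T U V (d : {linear U -> V}) (h : {linear T -> V}) :
  projective T -> (forall x, exists y, d y = h x) ->
  exists k : {linear T -> U}, forall x, d (k x) = h x.
Proof.
move=> pT im.
have ml : linear (fun x : U * T => d x.1 - h x.2).
  by move=> a x y /=; rewrite !linearP /= addrACA -scalerDr.
have ql : linear (fun w : lker_mod (mklin ml) => (val w).2).
  by move=> a x y; rewrite linearP.
have fl : linear (fun w : lker_mod (mklin ml) => (val w).1).
  by move=> a x y; rewrite linearP.
have [x|j jE] := pT _ _ (mklin ql) (idfun : {linear T -> T}).
  have [y yE] := im x.
  have [|w wE] := (ker_val_exact (mklin ml) (y, x)).1; first by rewrite /= yE subrr.
  by exists w; rewrite /= wE.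
exists (mklin fl \o j : {linear T -> U})%FUN => x.
have /eqP : mklin ml (val (j x)) = 0 by apply/ker_val_exact; exists (j x).
by rewrite subr_eq0 => /eqP e; apply: etrans e _; congr (h _); exact: jE.
Qed.

Lemma proj_presentation_prod N P U N' P' U' (i : {linear N -> P}) (p : {linear P -> U})
    (i' : {linear N' -> P'}) (p' : {linear P' -> U'}) :
  proj_presentation i p -> proj_presentation i' p' ->
  exists (j : {linear (N * N')%type -> (P * P')%type})
         (q : {linear (P * P')%type -> (U * U')%type}), proj_presentation j q.
Proof.
move=> [pP ps iinj ex] [pP' ps' i'inj ex'].
have jl : linear (fun x : N * N' => (i x.1, i' x.2)) by move=> a x y; rewrite !linearP.
have ql : linear (fun x : P * P' => (p x.1, p' x.2)) by move=> a x y; rewrite !linearP.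
exists (mklin jl), (mklin ql); split.
- exact: projective_prod.
- by move=> [u u']; have [x <-] := ps u; have [x' <-] := ps' u'; exists (x, x').
- by move=> [x x'] [y y'] [/iinj-> /i'inj->].
- move=> [x x']; split=> [[/ex[y <-] /ex'[y' <-]]|[[y y'] [<- <-]]]; first by exists (y, y').
  by congr pair; [apply/ex; exists y | apply/ex'; exists y'].
Qed.

End Presentations.

Section Syzygy.
Variables (A : nzRingType) (nA : nat).
Hypothesis lA : fin_len A^o nA.
Implicit Types M N P S T X Y : modA A.

Lemma lker_fin_gen (U V : lmodType A) (f : {linear U -> V}) :
  fin_gen U -> fin_gen (lker_mod f).
Proof.
move=> /(fin_gen_len lA)[n lU]; apply: fin_len_gen.
apply: (fin_len_inj (f := (val : lker_mod f -> U))) lU; exact: val_inj.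
Qed.

Definition free_rank M : nat := projT1 (cid (fin_gen_cover (mod_fin_gen M))).

Definition free_cover M : {linear 'rV[A]_(free_rank M) -> M} :=
  projT1 (cid (projT2 (cid (fin_gen_cover (mod_fin_gen M))))).

Lemma free_cover_surj M : surj (free_cover M).
Proof. exact: (projT2 (cid (projT2 (cid (fin_gen_cover (mod_fin_gen M)))))). Qed.

(** The kernel of a free cover is stably isomorphic to the syzygy, so both have the
    same class in K(A). *)
Definition omega M : modA A :=
  ModA (lker_fin_gen (free_cover M) (fin_gen_row A (free_rank M))).

Definition omega_inc M : {linear omega M -> 'rV[A]_(free_rank M)} :=
  (val : lker_mod (free_cover M) -> _).

Lemma omega_presentation M : proj_presentation (omega_inc M) (free_cover M).
Proof.
split; [exact: row_projective | exact: free_cover_surj | exact: val_inj |].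
exact: ker_val_exact.
Qed.

Lemma free_cover_inc M k : free_cover M (omega_inc M k) = 0.
Proof. by apply/ker_val_exact; exists k. Qed.

(** This is what makes the class of a syzygy independent of the presentation, in
    particular for projective covers. *)
Lemma K_class_syzygy N M M' (P : lmodType A) (i : {linear N -> P}) (p : {linear P -> M}) :
  proj_presentation i p -> K_class M = K_class M' -> K_class N = K_class (omega M').
Proof.
move=> pr /(K_class_stable_iso lA) st; apply: stable_iso_K_class.
exact: syzygy_stable_iso pr (omega_presentation M') st.
Qed.

(** Additivity holds because the product of two presentations presents the direct
    sum, and the class of a projective is killed because it has a presentation with
    kernel 0. *)
Lemma omega_morphism : exists Om : {additive K_group A -> K_group A},
  forall M, Om (K_class M) = K_class (omega M).
Proof.
have [N S T iso|P pP|Om OmE] :=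
    @K_group_lift A (fun c => K_class (omega (isoclass_rep c))).
- have [j [q pr]] := proj_presentation_prod (omega_presentation (isoclass_rep (iso_class S)))
    (omega_presentation (isoclass_rep (iso_class T))).
  rewrite -(@K_class_prod _ (modA_prod (omega _) (omega _)) _ _ (iso_refl _)).
  apply/esym; apply: (@K_class_syzygy (modA_prod _ _) (modA_prod _ _) _ _ j q pr).
  apply: K_class_iso; apply: iso_trans (iso_prod (isoclass_rep_iso _) (isoclass_rep_iso _)) _.
  exact: iso_trans (iso_sym iso) (iso_sym (isoclass_rep_iso _)).
- have pr : proj_presentation (\0 : {linear zero_mod A -> P})%R (idfun : {linear P -> P}).
    split=> //; first by move=> x; exists x.
      by move=> x y _; rewrite (zero_mod_trivial x) (zero_mod_trivial y).
    by move=> x; split=> [/= ->|[y <-]] //; exists 0.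
  rewrite -(K_class_projective (projective_trivial (@zero_mod_trivial A))).
  apply/esym; apply: (K_class_syzygy pr).
  exact/K_class_iso/iso_sym/isoclass_rep_iso.
exists Om => M; rewrite OmE; apply/esym.
apply: (K_class_syzygy (omega_presentation M)).
exact/K_class_iso/iso_sym/isoclass_rep_iso.
Qed.

Lemma is_syzygy_class M N : is_syzygy M N -> K_class N = K_class (omega M).
Proof.
move=> [P [f [i [[pP fs _] iinj ex]]]].
by apply: (@K_class_syzygy _ _ _ _ i f) => //; split.
Qed.

Lemma iter_omega_class (Om : {additive K_group A -> K_group A}) n X :
  (forall M, Om (K_class M) = K_class (omega M)) ->
  iter n Om (K_class X) = K_class (iter n omega X).
Proof. by move=> OmE; elim: n => //= n ->; rewrite OmE. Qed.

Definition fg_d X n : {linear 'rV[A]_(free_rank (iter n.+1 omega X)) ->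
    'rV[A]_(free_rank (iter n omega X))} :=
  omega_inc (iter n omega X) \o free_cover (iter n.+1 omega X).

Lemma fg_exact0 M x : free_cover M x = 0 <-> exists y, omega_inc M (free_cover (omega M) y) = x.
Proof.
split=> [/ker_val_exact[k <-]|[y <-]]; last by apply/ker_val_exact; exists (free_cover _ y).
by have [y <-] := @free_cover_surj (omega M) k; exists y.
Qed.

Lemma fg_exact X n x : fg_d X n x = 0 <-> exists y, fg_d X n.+1 y = x.
Proof.
rewrite -[X in _ <-> X]fg_exact0; split=> [h|h]; first exact: val_inj.
by rewrite -[LHS]/(omega_inc _ (free_cover _ x)) h linear0.
Qed.

(** Its syzygies lie in mod(A), where the functors are evaluated, in contrast with
    those of the canonical free resolution. *)
Definition fg_resolution X : proj_resolution X :=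
  @ProjResolution A X (fun n => 'rV[A]_(free_rank (iter n omega X)))
    (fg_d X) (free_cover X) (fun n => @row_projective A _) (@free_cover_surj X)
    (@fg_exact0 X) (@fg_exact X).

End Syzygy.

(** * Comparison of resolutions *)

Section FunctorIso.
Variables (R : comNzRingType) (A : algType R).
Implicit Types F G H : @rfunctor R A.

Lemma rfunctor_iso_inverse F G : rfunctor_iso F G ->
  exists (eta : forall Z, {linear F Z -> G Z}) (theta : forall Z, {linear G Z -> F Z}),
    [/\ forall Z, cancel (eta Z) (theta Z), forall Z, cancel (theta Z) (eta Z),
      forall (U V : modA A) (h : {linear U -> V}) x,
        eta V (fmap F h x) = fmap G h (eta U x)
    & forall (U V : modA A) (h : {linear U -> V}) x,
        theta V (fmap G h x) = fmap F h (theta U x)].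
Proof.
move=> [eta [etab nat]].
have inv Z := cid (bij_inverse (etab Z)).
exists eta, (fun Z => sval (inv Z)); split=> [Z|Z|//|U V h x].
- by case: (svalP (inv Z)).
- by case: (svalP (inv Z)).
have [_ K] := svalP (inv U); have [K' _] := svalP (inv V).
by apply: (can_inj K'); rewrite nat K; case: (svalP (inv V)) => _ ->.
Qed.

Lemma rfunctor_iso_sym F G : rfunctor_iso F G -> rfunctor_iso G F.
Proof.
move=> /rfunctor_iso_inverse[eta [theta [eK tK _ nat]]].
exists theta; split=> [Z|U V h x]; last exact: nat.
by exists (eta Z); [exact: tK | exact: eK].
Qed.

Lemma rfunctor_iso_trans F G H :
  rfunctor_iso F G -> rfunctor_iso G H -> rfunctor_iso F H.
Proof.
move=> [eta [eb en]] [theta [tb tn]].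
exists (fun Z => theta Z \o eta Z : {linear F Z -> H Z})%FUN; split=> [Z|U V h x].
  exact: (bij_comp (tb Z) (eb Z)).
by rewrite /= en tn.
Qed.

End FunctorIso.

Section Comparison.
Variables (R : comNzRingType) (A : algType R) (X Y : lmodType A).
Variables (P : proj_resolution X) (Q : proj_resolution Y) (n : nat).
Variables (psi : {linear res_mod Q n -> res_mod P n})
          (psi' : {linear res_mod Q n.+1 -> res_mod P n.+1}).
Hypothesis psiE : forall y, psi (res_d Q n y) = res_d P n (psi' y).

Lemma res_dd (X' : lmodType A) (T : proj_resolution X') m x :
  res_d T m (res_d T m.+1 x) = 0.
Proof. by apply/res_exact; exists x. Qed.

Definition hom_pre (U V Z : lmodType A) (k : {linear U -> V}) (c : Defs.Hom V Z) : Defs.Hom U Z :=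
  ((c : {linear V -> Z}) \o k : {linear U -> Z})%FUN.

Lemma hom_pre_cocycle Z (c : Defs.Hom (res_mod P n.+1) Z) :
  c \in @cocycle R A X P n.+1 Z -> hom_pre psi' c \in @cocycle R A Y Q n.+1 Z.
Proof.
move=> /asboolP c0; apply/asboolP => y.
have [z zE] : exists z, res_d P n.+1 z = psi' (res_d Q n.+1 y).
  by apply/res_exact; rewrite -psiE res_dd linear0.
exact: (etrans (congr1 (hom_fun c) (esym zE)) (c0 z)).
Qed.

Definition cocycle_pre Z (c : cocycle_mod P n.+1 Z) : cocycle_mod Q n.+1 Z :=
  CocycleMod (hom_pre_cocycle (valP c)).

Lemma cocycle_pre_linear Z : linear (@cocycle_pre Z).
Proof. by move=> a c c'; apply/val_inj/hom_ext. Qed.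

HB.instance Definition _ Z :=
  GRing.isLinear.Build R _ _ *:%R (@cocycle_pre Z) (@cocycle_pre_linear Z).

Lemma cocycle_pre_coboundary Z (c : cocycle_mod P n.+1 Z) :
  c \in @coboundary R A X P n.+1 Z -> cocycle_pre c \in @coboundary R A Y Q n.+1 Z.
Proof.
move=> /asboolP[g cE]; apply/asboolP; exists (hom_pre psi g) => x.
exact: (etrans (cE (psi' x)) (congr1 (hom_fun g) (esym (psiE x)))).
Qed.

Definition cohomology_pre Z : {linear cohomology P n.+1 Z -> cohomology Q n.+1 Z} :=
  quot_lmap (@cocycle_pre_coboundary Z).

Lemma cohomology_preE Z c : cohomology_pre Z (quot_pi _ c) = quot_pi _ (cocycle_pre c).
Proof. exact: (quot_mapE (@cocycle_pre_coboundary Z)). Qed.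

End Comparison.

Section ComparisonIso.
Variables (R : comNzRingType) (A : algType R) (X Y : lmodType A).
Variables (P : proj_resolution X) (Q : proj_resolution Y).

(** The trace in degrees n and n+1 of a homotopy equivalence of complexes, with the
    homotopies considered on boundaries only. Cohomology in degree n+1 depends on
    nothing else. *)
Definition homotopic_at n : Prop :=
  exists (phi : {linear res_mod P n -> res_mod Q n})
    (phi' : {linear res_mod P n.+1 -> res_mod Q n.+1})
    (psi : {linear res_mod Q n -> res_mod P n})
    (psi' : {linear res_mod Q n.+1 -> res_mod P n.+1})
    (r : {linear res_mod P n -> res_mod P n.+1})
    (s : {linear res_mod Q n -> res_mod Q n.+1}),
  [/\ forall x, phi (res_d P n x) = res_d Q n (phi' x),
      forall y, psi (res_d Q n y) = res_d P n (psi' y),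
      forall x, res_d P n x - psi (phi (res_d P n x)) = res_d P n (r (res_d P n x))
    & forall y, res_d Q n y - phi (psi (res_d Q n y)) = res_d Q n (s (res_d Q n y))].

End ComparisonIso.

Section HomotopicTheory.
Variables (R : comNzRingType) (A : algType R).

(** The identity minus psi' phi' equals r composed with the differential up to
    boundaries, so it changes a cocycle by a coboundary. *)
Lemma cohomology_pre_cancel (X Y : lmodType A) (P : proj_resolution X)
    (Q : proj_resolution Y) n
    (phi : {linear res_mod P n -> res_mod Q n})
    (phi' : {linear res_mod P n.+1 -> res_mod Q n.+1})
    (psi : {linear res_mod Q n -> res_mod P n})
    (psi' : {linear res_mod Q n.+1 -> res_mod P n.+1})
    (r : {linear res_mod P n -> res_mod P n.+1})
    (phiE : forall x, phi (res_d P n x) = res_d Q n (phi' x))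
    (psiE : forall y, psi (res_d Q n y) = res_d P n (psi' y)) Z :
  (forall x, res_d P n x - psi (phi (res_d P n x)) = res_d P n (r (res_d P n x))) ->
  cancel (@cohomology_pre R A X Y P Q n psi psi' psiE Z)
         (@cohomology_pre R A Y X Q P n phi phi' phiE Z).
Proof.
move=> rE q; have [c <-] := quot_pi_surj q; rewrite !cohomology_preE.
apply/esym/quot_piP/asboolP; exists (hom_pre r (val c)) => x.
have /asboolP c0 := valP c.
rewrite [LHS]/(hom_fun (val c) x - hom_fun (val c) (psi' (phi' x))).
have [z zE] : exists z, res_d P n.+1 z = x - psi' (phi' x) - r (res_d P n x).
  by apply/res_exact; rewrite !linearB /= -psiE -phiE -rE subrr.
have /eqP := c0 z; rewrite zE /hom_fun !linearB subr_eq0 => /eqP.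
by [].
Qed.

Lemma homotopic_cohomology_iso (X Y : lmodType A) (P : proj_resolution X)
    (Q : proj_resolution Y) n :
  homotopic_at P Q n ->
  rfunctor_iso (@cohomology_functor R A X P n.+1) (@cohomology_functor R A Y Q n.+1).
Proof.
move=> [phi [phi' [psi [psi' [r [s [phiE psiE rE sE]]]]]]].
exists (fun Z : modA A => @cohomology_pre R A X Y P Q n psi psi' psiE Z).
split=> [Z|U V h q].
  exists (@cohomology_pre R A Y X Q P n phi phi' phiE Z).
    exact: cohomology_pre_cancel rE.
  exact: cohomology_pre_cancel sE.
have [c <-] := quot_pi_surj q.
rewrite -[LHS]/(cohomology_pre psiE V (cohomology_map P n.+1 h (quot_pi _ c))).
rewrite -[RHS]/(cohomology_map Q n.+1 h (cohomology_pre psiE U (quot_pi _ c))).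
rewrite cohomology_mapE !cohomology_preE cohomology_mapE.
by congr quot_pi; exact/val_inj/hom_ext.
Qed.

(** The defect of the homotopy in degree n+1 consists of cycles, so it lifts along
    the next differential. *)
Lemma homotopic_step (X Y : lmodType A) (P : proj_resolution X)
    (Q : proj_resolution Y) n : homotopic_at P Q n -> homotopic_at P Q n.+1.
Proof.
move=> [phi [phi' [psi [psi' [r [s [phiE psiE rE sE]]]]]]].
have lift (X1 X2 : lmodType A) (P1 : proj_resolution X1) (P2 : proj_resolution X2)
    (f : {linear res_mod P1 n -> res_mod P2 n})
    (f' : {linear res_mod P1 n.+1 -> res_mod P2 n.+1}) :
    (forall x, f (res_d P1 n x) = res_d P2 n (f' x)) ->
    exists f'' : {linear res_mod P1 n.+2 -> res_mod P2 n.+2},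
      forall x, f' (res_d P1 n.+1 x) = res_d P2 n.+1 (f'' x).
  move=> fE; have [x|k kE] := @projective_lift A _ _ _ (res_d P2 n.+1)
      (f' \o res_d P1 n.+1 : {linear _ -> _})%FUN (@res_projective _ _ P1 n.+2).
    by apply/res_exact; rewrite /= -fE res_dd linear0.
  by exists k => x; rewrite kE.
have homo (X1 X2 : lmodType A) (P1 : proj_resolution X1) (P2 : proj_resolution X2)
    (f : {linear res_mod P1 n -> res_mod P2 n})
    (f' : {linear res_mod P1 n.+1 -> res_mod P2 n.+1})
    (g : {linear res_mod P2 n -> res_mod P1 n})
    (g' : {linear res_mod P2 n.+1 -> res_mod P1 n.+1})
    (t : {linear res_mod P1 n -> res_mod P1 n.+1}) :
    (forall x, f (res_d P1 n x) = res_d P2 n (f' x)) ->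
    (forall y, g (res_d P2 n y) = res_d P1 n (g' y)) ->
    (forall x, res_d P1 n x - g (f (res_d P1 n x)) = res_d P1 n (t (res_d P1 n x))) ->
    exists t' : {linear res_mod P1 n.+1 -> res_mod P1 n.+2}, forall x,
      res_d P1 n.+1 x - g' (f' (res_d P1 n.+1 x)) =
      res_d P1 n.+1 (t' (res_d P1 n.+1 x)).
  move=> fE gE tE.
  have [x|k kE] := @projective_lift A _ _ _ (res_d P1 n.+1)
      ((idfun \- (g' \o f')) \- (t \o res_d P1 n) : {linear _ -> _})%FUN
      (@res_projective _ _ P1 n.+1).
    by apply/res_exact; rewrite /= !linearB /= -gE -fE -tE subrr.
  by exists k => x; rewrite kE /= res_dd linear0 subr0.
have [phi'' phi''E] := lift _ _ _ _ _ _ phiE.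
have [psi'' psi''E] := lift _ _ _ _ _ _ psiE.
have [r' r'E] := homo _ _ _ _ _ _ _ _ _ phiE psiE rE.
have [s' s'E] := homo _ _ _ _ _ _ _ _ _ psiE phiE sE.
by exists phi', phi'', psi', psi'', r', s'.
Qed.

(** Lift the two maps to the complexes. The part of the identity that factors
    through a projective is a composite through U or V, and so it vanishes on
    boundaries. *)
Lemma stable_iso_homotopic (X Y U V : lmodType A) (P : proj_resolution X)
    (Q : proj_resolution Y) n (p : {linear res_mod P n -> U})
    (q : {linear res_mod Q n -> V}) :
  surj p -> (forall x, p x = 0 <-> exists y, res_d P n y = x) ->
  surj q -> (forall x, q x = 0 <-> exists y, res_d Q n y = x) ->
  stable_iso U V -> homotopic_at P Q n.
Proof.
move=> ps pe qs qe [f [g [gf fg]]].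
have lift (X1 X2 U1 U2 : lmodType A) (P1 : proj_resolution X1) (P2 : proj_resolution X2)
    (p1 : {linear res_mod P1 n -> U1}) (p2 : {linear res_mod P2 n -> U2})
    (k : {linear U1 -> U2}) :
    surj p2 -> (forall x, p1 (res_d P1 n x) = 0) ->
    (forall x, p2 x = 0 <-> exists y, res_d P2 n y = x) ->
    exists (K : {linear res_mod P1 n -> res_mod P2 n})
      (K' : {linear res_mod P1 n.+1 -> res_mod P2 n.+1}),
      (forall x, p2 (K x) = k (p1 x)) /\
      (forall x, K (res_d P1 n x) = res_d P2 n (K' x)).
  move=> p2s p1d p2e.
  have [K KE] := @res_projective _ _ P1 n _ _ p2 (k \o p1 : {linear _ -> _})%FUN p2s.
  have [x|K' K'E] := @projective_lift A _ _ _ (res_d P2 n)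
      (K \o res_d P1 n : {linear _ -> _})%FUN (@res_projective _ _ P1 n.+1).
    by apply/p2e; rewrite /= KE /= p1d linear0.
  by exists K, K'; split=> // x; rewrite K'E.
have homo (X1 U1 : lmodType A) (P1 : proj_resolution X1)
    (p1 : {linear res_mod P1 n -> U1}) (h : U1 -> U1)
    (E : {linear res_mod P1 n -> res_mod P1 n}) :
    surj p1 -> (forall x, p1 x = 0 <-> exists y, res_d P1 n y = x) ->
    factors_proj h -> (forall x, p1 (E x) = h (p1 x)) ->
    exists t : {linear res_mod P1 n -> res_mod P1 n.+1}, forall x,
      E (res_d P1 n x) = res_d P1 n (t (res_d P1 n x)).
  move=> p1s p1e [T [s [t [pT hE]]]] EE.
  have [t' t'E] := pT _ _ p1 t p1s.
  have [x|k kE] := @projective_lift A _ _ _ (res_d P1 n)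
      (E \- (t' \o (s \o p1)) : {linear _ -> _})%FUN (@res_projective _ _ P1 n).
    by apply/p1e; rewrite linearB /= EE hE t'E subrr.
  exists k => x; rewrite kE /=.
  have -> : p1 (res_d P1 n x) = 0 by apply/p1e; exists x.
  by rewrite !linear0 addr0.
have pd x : p (res_d P n x) = 0 by apply/pe; exists x.
have qd x : q (res_d Q n x) = 0 by apply/qe; exists x.
have [phi [phi' [phiE phi'E]]] := lift _ _ _ _ P Q p q f qs pd qe.
have [psi [psi' [psiE psi'E]]] := lift _ _ _ _ Q P q p g ps qd pe.
have [x|r rE] := homo _ _ P p _ (idfun \- (psi \o phi))%FUN ps pe gf.
  by rewrite linearB /= psiE phiE.
have [x|s sE] := homo _ _ Q q _ (idfun \- (phi \o psi))%FUN qs qe fg.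
  by rewrite linearB /= phiE psiE.
by exists phi, phi', psi, psi', r, s.
Qed.

End HomotopicTheory.

(** * Ext functors and stable isomorphism of syzygies *)

Section ExtClasses.
Variables (R : comNzRingType) (A : algType R) (nA : nat).
Hypothesis lA : fin_len A^o nA.
Variables (X : modA A) (n : nat).

Let P := fg_resolution lA X.
Let U : modA A := iter n (omega lA) X.
Let K : modA A := omega lA U.

Lemma ext_class_cocycle (Z : lmodType A) (h : {linear K -> Z}) :
  (h \o free_cover K : {linear _ -> Z})%FUN \in @cocycle R A X P n.+1 Z.
Proof.
apply/asboolP => x.
have z := free_cover_inc (free_cover (omega lA K) x).
exact: (etrans (congr1 h z) (linear0 h)).
Qed.

(** Cohomology in degree n+1 as the cokernel of restriction along the
    inclusion of the (n+1)-st syzygy, which makes it a quotient of a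
    representable functor. *)
Definition ext_class (Z : lmodType A) (h : {linear K -> Z}) :
  @cohomology R A X P n.+1 Z := quot_pi _ (CocycleMod (ext_class_cocycle h)).

Lemma ext_class_surj (Z : lmodType A) q : exists h : {linear K -> Z}, ext_class h = q.
Proof.
have [c <-] := quot_pi_surj q; have /asboolP c0 := valP c.
have [x x0|h hE] := @coker_factor A _ _ Z (free_cover K) (val c) (@free_cover_surj _ K).
  have [y yE] := (fg_exact0 lA x).1 x0.
  by have := c0 y; rewrite -yE.
exists h; congr quot_pi; apply/val_inj/hom_ext => x; exact: hE.
Qed.

Lemma ext_class_eq (Z : lmodType A) (h h' : {linear K -> Z}) :
  ext_class h = ext_class h' <->
  exists t : {linear 'rV[A]_(free_rank U) -> Z},
    forall k, h k - h' k = t (omega_inc lA U k).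
Proof.
split=> [/quot_piP/asboolP[t tE]|[t tE]].
  exists t => k; have [x <-] := free_cover_surj k; exact: tE.
by apply/quot_piP/asboolP; exists t => x; exact: tE.
Qed.

Lemma ext_class_map (Y Z : lmodType A) (g : {linear Y -> Z}) (h : {linear K -> Y}) :
  cohomology_map P n.+1 g (ext_class h) = ext_class (g \o h : {linear K -> Z})%FUN.
Proof.
by rewrite /ext_class cohomology_mapE; congr quot_pi; exact/val_inj/hom_ext.
Qed.

End ExtClasses.

Section HiltonRees.
Variables (R : comNzRingType) (A : algType R) (nA : nat).
Hypothesis lA : fin_len A^o nA.
Implicit Types X Y : modA A.

Let H X n := @cohomology_functor R A X (fg_resolution lA X) n.+1.

(** By Yoneda a natural map is precomposition with the map a of syzygies that
    represents the image of the universal class. The inclusion of a syzygy into its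
    free cover has class 0, hence so has its composite with a; this composite then
    extends to a map al of free covers, which induces a map f of cokernels. For
    mutually inverse natural maps, the composite of the two induced maps differs
    from the identity by a map through a free module. *)
Lemma cohomology_iso_stable X Y n : rfunctor_iso (H X n) (H Y n) ->
  stable_iso (iter n (omega lA) X) (iter n (omega lA) Y).
Proof.
move=> /rfunctor_iso_inverse[eta [theta [etaK thetaK etaN thetaN]]].
have represent X1 X2 (nu : forall Z : modA A, {linear H X1 n Z -> H X2 n Z}) :
    (forall (U V : modA A) (h : {linear U -> V}) x,
      nu V (fmap (H X1 n) h x) = fmap (H X2 n) h (nu U x)) ->
    exists (a : {linear iter n.+1 (omega lA) X2 -> iter n.+1 (omega lA) X1})
      (al : {linear 'rV[A]_(free_rank (iter n (omega lA) X2)) ->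
             'rV[A]_(free_rank (iter n (omega lA) X1))})
      (f : {linear iter n (omega lA) X2 -> iter n (omega lA) X1}),
    [/\ forall (Z : modA A) (h : {linear iter n.+1 (omega lA) X1 -> Z}),
          nu Z (ext_class h) = ext_class (h \o a : {linear _ -> Z})%FUN,
        forall k, al (omega_inc lA _ k) = omega_inc lA _ (a k)
      & forall x, f (free_cover _ x) = free_cover _ (al x)].
  move=> nuN; set K1 := iter n.+1 (omega lA) X1.
  have [a aE] := @ext_class_surj R A nA lA X2 n K1
    (nu K1 (@ext_class R A nA lA X1 n K1 (idfun : {linear K1 -> K1}))).
  have nuE (Z : modA A) (h : {linear K1 -> Z}) :
      nu Z (@ext_class R A nA lA X1 n Z h) =
      @ext_class R A nA lA X2 n Z (h \o a : {linear _ -> Z})%FUN.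
    rewrite -ext_class_map aE; apply: etrans _ (nuN _ _ h _); congr (nu Z _).
    rewrite [RHS]ext_class_map; congr quot_pi; exact/val_inj/hom_ext.
  pose inc1 := omega_inc lA (iter n (omega lA) X1).
  pose F1 := modA_row A (free_rank (iter n (omega lA) X1)).
  (* the inclusion extends to the free cover, by the identity *)
  have inc0 : @ext_class R A nA lA X1 n F1 inc1 = @ext_class R A nA lA X1 n F1 (\0)%R.
    by apply/ext_class_eq; exists (idfun : {linear F1 -> F1}) => k; rewrite /= subr0.
  have := congr1 (nu F1) inc0; rewrite !nuE => /ext_class_eq[al alE].
  have [x x0|f fE] := @coker_factor A _ _ _ (free_cover (iter n (omega lA) X2))
    (free_cover _ \o al : {linear _ -> iter n (omega lA) X1})%FUN (@free_cover_surj _ _).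
    have [k <-] := (ker_val_exact _ _).1 x0.
    rewrite /= -[al _]/(al (omega_inc lA _ k)) -alE /= subr0.
    exact: (free_cover_inc (a k)).
  by exists a, al, f; split=> // k; rewrite -alE /= subr0.
have [a [al [f [aE alE fE]]]] := represent _ _ _ etaN.
have [b [be [g [bE beE gE]]]] := represent _ _ _ thetaN.
have half X1 X2 (nu : forall Z : modA A, {linear H X1 n Z -> H X2 n Z})
    (mu : forall Z : modA A, {linear H X2 n Z -> H X1 n Z})
    (a1 : {linear iter n.+1 (omega lA) X2 -> iter n.+1 (omega lA) X1})
    (al1 : {linear 'rV[A]_(free_rank (iter n (omega lA) X2)) ->
           'rV[A]_(free_rank (iter n (omega lA) X1))})
    (f1 : {linear iter n (omega lA) X2 -> iter n (omega lA) X1})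
    (a2 : {linear iter n.+1 (omega lA) X1 -> iter n.+1 (omega lA) X2})
    (al2 : {linear 'rV[A]_(free_rank (iter n (omega lA) X1)) ->
           'rV[A]_(free_rank (iter n (omega lA) X2))})
    (f2 : {linear iter n (omega lA) X1 -> iter n (omega lA) X2}) :
    (forall Z, cancel (nu Z) (mu Z)) ->
    (forall (Z : modA A) (h : {linear iter n.+1 (omega lA) X1 -> Z}),
          nu Z (ext_class h) = ext_class (h \o a1 : {linear _ -> Z})%FUN) ->
    (forall (Z : modA A) (h : {linear iter n.+1 (omega lA) X2 -> Z}),
          mu Z (ext_class h) = ext_class (h \o a2 : {linear _ -> Z})%FUN) ->
    (forall k, al1 (omega_inc lA _ k) = omega_inc lA _ (a1 k)) ->
    (forall k, al2 (omega_inc lA _ k) = omega_inc lA _ (a2 k)) ->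
    (forall x, f1 (free_cover _ x) = free_cover _ (al1 x)) ->
    (forall x, f2 (free_cover _ x) = free_cover _ (al2 x)) ->
    factors_proj (fun x => x - f1 (f2 x)).
  move=> nuK nuE muE al1E al2E f1E f2E.
  set K1 := iter n.+1 (omega lA) X1.
  have := nuK K1 (@ext_class R A nA lA X1 n K1 (idfun : {linear K1 -> K1})).
  rewrite nuE muE => /esym/ext_class_eq[t tE].
  pose m := ((idfun \- (al1 \o al2)) \-
    (omega_inc lA (iter n (omega lA) X1) \o t) : {linear _ -> _})%FUN.
  have [x x0|s sE] :=
      @coker_factor A _ _ _ (free_cover (iter n (omega lA) X1)) m (@free_cover_surj _ _).
    have [k <-] := (ker_val_exact _ _).1 x0.
    rewrite /m /= -[val k]/(omega_inc lA _ k) al2E al1E -tE /= !linearB /=.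
    by rewrite -opprD subrr.
  exists _, s, (free_cover (iter n (omega lA) X1)); split; first exact: row_projective.
  move=> u; have [x <-] := free_cover_surj u; rewrite sE /m /= !linearB /= f2E f1E.
  have z : free_cover (iter n (omega lA) X1) (lker_val (t x)) = 0.
    exact: (free_cover_inc (t x)).
  by rewrite z subr0.
by exists g, f; split; [apply: half etaK _ _ _ _ _ _ | apply: half thetaK _ _ _ _ _ _].
Qed.

Lemma Ext_fg_iso X n : rfunctor_iso (Ext n.+1 X) (H X n).
Proof.
apply: homotopic_cohomology_iso; elim: n => [|n IH]; last exact: homotopic_step.
have z0 := projective_trivial (@zero_mod_trivial A).
apply: (@stable_iso_homotopic R A X X X X _ _ 0 (res_aug _) (res_aug _)).
- exact: res_aug_surj.
- exact: res_exact0.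
- exact: res_aug_surj.
- exact: res_exact0.
- exact: (iso_proj_stable z0 z0 (iso_refl _)).
Qed.

Lemma stable_cohomology_iso X Y n :
  stable_iso (iter n (omega lA) X) (iter n (omega lA) Y) ->
  rfunctor_iso (H X n) (H Y n).
Proof.
move=> st; apply: homotopic_cohomology_iso.
by apply: stable_iso_homotopic st; [exact: free_cover_surj | exact: fg_exact0
  | exact: free_cover_surj | exact: fg_exact0].
Qed.

(** Both sides say that the n-th syzygies of X and Y are stably isomorphic. *)
Lemma Ext_iso_iter (Om : {additive K_group A -> K_group A}) X Y n :
  (forall M, Om (K_class M) = K_class (omega lA M)) ->
  rfunctor_iso (Ext n.+1 X) (Ext n.+1 Y) <->
  iter n Om (K_class X) = iter n Om (K_class Y).
Proof.
move=> OmE; rewrite !(iter_omega_class _ _ OmE); split=> [iso|eXY].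
  apply: stable_iso_K_class; apply: cohomology_iso_stable.
  apply: rfunctor_iso_trans (rfunctor_iso_sym (Ext_fg_iso X n)) _.
  exact: rfunctor_iso_trans iso (Ext_fg_iso Y n).
apply: rfunctor_iso_trans (Ext_fg_iso X n) _.
apply: rfunctor_iso_trans _ (rfunctor_iso_sym (Ext_fg_iso Y n)).
exact/stable_cohomology_iso/(K_class_stable_iso lA).
Qed.

End HiltonRees.

(** * Ascending chains of subgroups *)

Import Order.TTheory Num.Theory.

Section AscendingSubgroups.

Definition subgroup (G : zmodType) (H : set G) : Prop :=
  H 0 /\ forall x y, H x -> H y -> H (x - y).

Lemma subgroupD (G : zmodType) (H : set G) x y : subgroup H -> H x -> H y -> H (x + y).
Proof.
by move=> [H0 HB] Hx Hy; rewrite -[y]opprK -[- y]add0r; apply: (HB) => //; exact: HB.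
Qed.

Lemma subgroupMz (G : zmodType) (H : set G) x (c : int) : subgroup H -> H x -> H (x *~ c).
Proof.
move=> sH Hx; have Hn n : H (x *+ n).
  elim: n => [|n IH]; first by case: sH.
  by rewrite mulrS; exact: subgroupD.
case: c => n; first exact: Hn.
by rewrite NegzE mulrNz -[- _]add0r; case: sH => H0; apply=> //; exact: Hn.
Qed.

(** The least positive integer that occurs in one of the subgroups generates all
    later ones. *)
Lemma int_subgroup_acc (D : nat -> set int) :
  (forall n, subgroup (D n)) -> (forall m n, (m <= n)%N -> D m `<=` D n) ->
  exists k, forall n, D n `<=` D k.
Proof.
move=> sD uD.
have [nz|z] := pselect (exists m, (0 < m)%N && `[< exists n, D n m%:Z >]); last first.
  exists 0%N => n x Dx; case: (eqVneq x 0) => [->|x0]; first by case: (sD 0%N).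
  exfalso; apply: z; exists `|x|%N; rewrite absz_gt0 x0; apply/asboolP; exists n.
  by rewrite abszEsg mulrC -mulrzz; exact: subgroupMz.
case: (ex_minnP nz) => d /andP[d0 /asboolP[k Dd]] mind.
exists k => n x Dx.
have Dd' : D (maxn k n) d%:Z by apply: uD Dd; exact: leq_maxl.
have Dx' : D (maxn k n) x by apply: uD Dx; exact: leq_maxr.
have dn0 : d%:Z != 0 by rewrite eqz_nat -lt0n.
have Dmod : D (maxn k n) (x %% d)%Z.
  case: (sD (maxn k n)) => _; apply=> //.
  by rewrite mulrC -mulrzz; exact: subgroupMz.
rewrite (divz_eq x d); suff -> : (x %% d)%Z = 0.
  by rewrite addr0 mulrC -mulrzz; exact: subgroupMz.
apply/eqP; apply: contrapT => /negP r0.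
have r_ge0 : 0 <= (x %% d)%Z by exact: modz_ge0.
have := mind `|(x %% d)%Z|%N; rewrite absz_gt0 r0 gez0_abs //=.
rewrite asboolT; last by exists (maxn k n).
by move=> /(_ isT); rewrite -lez_nat gez0_abs // leNgt ltz_pmod // ltz_nat.
Qed.

Lemma subrBB (G : zmodType) (x y u v : G) : x - y - (u - v) = x - u - (y - v).
Proof. by rewrite !opprB [v - u]addrC [v - y]addrC addrACA. Qed.

(** Adjoining one generator at a time is the form that suits induction on the
    number of generators. *)
Fixpoint zspan (G : zmodType) (gs : seq G) (x : G) : Prop :=
  if gs is g :: gs' then exists c : int, zspan gs' (x - g *~ c) else x = 0.

Lemma zspan_subgroup (G : zmodType) (gs : seq G) : subgroup (zspan gs).
Proof.
elim: gs => [|g gs [IH0 IHB]] /=; split=> //.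
- by move=> x y /= -> ->; rewrite subrr.
- by exists 0; rewrite mulr0z subr0.
- move=> x y [c xc] [d yd]; exists (c - d).
  by rewrite mulrzBr subrBB; exact: IHB.
Qed.

Lemma zspan_mem (G : zmodType) (gs : seq G) x : x \in gs -> zspan gs x.
Proof.
elim: gs => //= g gs IH; rewrite inE => /predU1P[->|/IH xg].
  by exists 1; rewrite mulr1z subrr; case: (zspan_subgroup gs).
by exists 0; rewrite mulr0z subr0.
Qed.

(** A subgroup of the span of g :: gs is determined, among those containing it, by
    its intersection with the span of gs and the set of its coefficients at g. *)
Lemma zspan_acc (G : zmodType) (gs : seq G) (H : nat -> set G) :
  (forall n, subgroup (H n)) -> (forall m n, (m <= n)%N -> H m `<=` H n) ->
  (forall n, H n `<=` zspan gs) -> exists k, forall n, H n `<=` H k.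
Proof.
elim: gs H => [|g gs IH] H sH uH Hgs.
  by exists 0%N => n x /Hgs ->; case: (sH 0%N).
have [sS0 sSB] := zspan_subgroup gs.
have [|||k1 k1P] := IH (fun n => H n `&` zspan gs).
- move=> n; have [H0 HB] := sH n; split=> // x y [Hx Sx] [Hy Sy].
  by split; [exact: HB | exact: sSB].
- by move=> m n mn x [Hx Sx]; split=> //; exact: uH Hx.
- by move=> n x [].
have [||k2 k2P] := @int_subgroup_acc
    (fun n => [set c | exists2 h, H n h & zspan gs (h - g *~ c)]).
- move=> n; have [H0 HB] := sH n; split.
    by exists 0; rewrite // mulr0z subr0.
  move=> c d [h Hh hc] [h' Hh' hd]; exists (h - h'); first exact: HB.
  by rewrite mulrzBr subrBB; exact: sSB.
- by move=> m n mn c [h Hh hc]; exists h => //; exact: uH Hh.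
exists (maxn k1 k2) => n x Hx; have [c xc] := Hgs n x Hx.
have [|h Hh hc] := k2P n c; first by exists x.
have Hh' : H (maxn k1 k2) h by apply: uH Hh; exact: leq_maxr.
rewrite -(subrK h x); apply: subgroupD => //; apply: (uH k1); first exact: leq_maxl.
have [] // := k1P (maxn n k2) (x - h).
split.
  case: (sH (maxn n k2)) => _; apply; first by apply: uH Hx; exact: leq_maxl.
  by apply: uH Hh; exact: leq_maxr.
have := sSB _ _ xc hc; congr (zspan gs _).
by rewrite opprB addrA subrK.
Qed.

End AscendingSubgroups.

(** * Summands of powers of a module *)

Section AdditiveClosure.
Variable A : nzRingType.
Implicit Types M W X Y Z : modA A.

Lemma in_addP M X : in_add M X <-> exists n, retract X {ffun 'I_n -> M}.
Proof.
by split=> -[n h]; exists n; [apply: (direct_summandP _ _).1 | apply: (direct_summandP _ _).2].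
Qed.

Lemma in_add_retract M X Y : retract X Y -> in_add M Y -> in_add M X.
Proof.
move=> rXY /in_addP[n rY]; apply/in_addP; exists n; exact: retract_trans rY.
Qed.

Lemma in_add_trivial M X : trivial_module X -> in_add M X.
Proof.
move=> X0; apply/in_addP; exists 0%N, (\0)%R, (\0)%R => x.
by rewrite (X0 x).
Qed.

Lemma retract_in_add M X : retract X M -> in_add M X.
Proof.
move=> rXM; apply: (in_add_retract rXM); apply/in_addP; exists 1%N.
have il : linear (fun x : M => [ffun _ : 'I_1 => x]).
  by move=> a x y; apply/ffunP => i; rewrite !ffunE.
have pl : linear (fun f : {ffun 'I_1 -> M} => f ord0).
  by move=> a f g; rewrite !ffunE.
by exists (mklin il), (mklin pl) => x; rewrite /= ffunE.
Qed.

Lemma in_add_prod M X Y : in_add M X -> in_add M Y -> in_add M (modA_prod X Y).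
Proof.
move=> /in_addP[m [i [p iK]]] /in_addP[n [j [q jK]]]; apply/in_addP; exists (m + n)%N.
pose I (x : X * Y) : {ffun 'I_(m + n) -> M} := [ffun k =>
  match split k with inl a => i x.1 a | inr b => j x.2 b end].
have Il : linear I.
  by move=> a x y; apply/ffunP => k; rewrite !ffunE; case: split => c;
     rewrite /= linearP !ffunE.
have pl : linear (fun f : {ffun 'I_(m + n) -> M} =>
    (p [ffun a => f (lshift n a)], q [ffun b => f (rshift m b)])).
  move=> a f g; rewrite -[RHS]/(_ *: p _ + p _, _ *: q _ + q _) -!linearP.
  by congr (p _, q _); apply/ffunP => k; rewrite !ffunE.
exists (mklin Il), (mklin pl) => -[x y] /=; congr pair.
  rewrite -[RHS]iK; congr (p _); apply/ffunP => a; rewrite !ffunE.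
  by rewrite (unsplitK (inl a)).
rewrite -[RHS]jK; congr (q _); apply/ffunP => b; rewrite !ffunE.
by rewrite (unsplitK (inr b)).
Qed.

(** Since the endomorphism ring of W is local, W splits off one of the factors of
    the power of M. *)
Lemma in_add_indecomposable M W n : fin_len W n -> indecomposable W ->
  in_add M W -> retract W M.
Proof.
move=> lW iW /in_addP[m]; elim: m => [|m IH] rW.
  case: iW => nW _; case: nW => w; have [i [p iK]] := rW.
  by rewrite -[w]iK (_ : i w = 0) ?linear0 //; apply/ffunP; case.
have il : linear (fun f : {ffun 'I_m.+1 -> M} =>
    (f ord0, [ffun k : 'I_m => f (fintype.lift ord0 k)])).
  move=> a f g; congr pair; first by rewrite !ffunE.
  by apply/ffunP => k; rewrite !ffunE.
have pl : linear (fun x : M * {ffun 'I_m -> M} => [ffun k : 'I_m.+1 =>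
    oapp x.2 x.1 (unlift ord0 k)]).
  by move=> a x y; apply/ffunP => k; rewrite !ffunE; case: unlift => [k'|] //=;
     rewrite !ffunE.
have split : retract {ffun 'I_m.+1 -> M} (M * {ffun 'I_m -> M})%type.
  exists (mklin il), (mklin pl) => f /=; apply/ffunP => k; rewrite !ffunE.
  by case: unliftP => [k' ->|->] //=; rewrite ffunE.
have [//|/IH//] := retract_prod lW iW (retract_trans rW split).
Qed.

End AdditiveClosure.

(** * The subgroup spanned by a module *)

Section Span.
Variables (A : nzRingType) (nA : nat).
Hypothesis lA : fin_len A^o nA.
Implicit Types M S T W X Y Z : modA A.

Lemma isomorphic_indecomposable (U V : lmodType A) :
  isomorphic U V -> indecomposable V -> indecomposable U.
Proof.
move=> iso [nV iV]; split; first by move=> U0; apply: nV; exact: iso_trivial U0.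
by move=> S T isoST; apply: iV; exact: iso_trans (iso_sym iso) isoST.
Qed.

Lemma modA_split X (S T : lmodType A) : isomorphic X (S * T)%type ->
  exists S' T' : modA A, isomorphic X (S' * T')%type /\
    isomorphic S S' /\ isomorphic T T'.
Proof.
move=> iso.
have gS : fin_gen S.
  apply: fin_gen_retract (mod_fin_gen X).
  exact: retract_trans (retract_prodl S T) (retract_iso (iso_sym iso)).
have gT : fin_gen T.
  apply: fin_gen_retract (mod_fin_gen X).
  exact: retract_trans (retract_prodr S T) (retract_iso (iso_sym iso)).
by exists (ModA gS), (ModA gT); split=> //; split; exact: iso_refl.
Qed.

Lemma modA_ind (P : modA A -> Prop) :
  (forall X, trivial_module X -> P X) -> (forall X, indecomposable X -> P X) ->
  (forall X S T, isomorphic X (S * T)%type -> P S -> P T -> P X) ->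
  forall X, P X.
Proof.
move=> P0 P1 P2 X; have [n lX] := modA_len lA X.
suff : forall V n, fin_len V n -> forall X, isomorphic X V -> P X.
  by move=> /(_ X n lX X); apply; exact: iso_refl.
move=> {X n lX}; apply: fin_len_ind => [V V0|V n _ iV|V S T iso IS IT] X XV.
- by apply: P0; exact: iso_trivial (iso_sym XV) V0.
- by apply: P1; exact: isomorphic_indecomposable XV iV.
have [S' [T' [isoX [SS' TT']]]] := modA_split (iso_trans XV iso).
by apply: P2 isoX _ _; [apply: IS | apply: IT]; exact: iso_sym.
Qed.

Lemma in_add_factors M X S T : isomorphic X (S * T)%type -> in_add M X ->
  in_add M S /\ in_add M T.
Proof.
move=> /iso_sym/retract_iso r aX; split.
  exact: in_add_retract (retract_trans (retract_prodl S T) r) aX.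
exact: in_add_retract (retract_trans (retract_prodr S T) r) aX.
Qed.

Lemma indecomposable_in_add M W : indecomposable W -> in_add M W -> retract W M.
Proof. by have [n lW] := modA_len lA W; exact: in_add_indecomposable lW. Qed.

Lemma K_span_subgroup M : subgroup [set` K_span M].
Proof. exact: gen_subgroup_closed. Qed.

Lemma K_span_add M X : in_add M X -> K_class X \in K_span M.
Proof.
have sM := K_span_subgroup M.
elim/modA_ind: X => [X X0 _|X iX aX|X S T iso IS IT aX].
- by rewrite K_class_projective ?(proj1 sM) //; exact: projective_trivial.
- have [pX|nX] := pselect (projective X).
    by rewrite K_class_projective ?(proj1 sM).
  apply/asboolP => U _; apply; exists X; split=> //.
  exact/direct_summandP/indecomposable_in_add.
have [aS aT] := in_add_factors iso aX.
rewrite (K_class_prod iso); exact: (subgroupD sM (IS aS) (IT aT)).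
Qed.

Lemma K_span_difference M x : x \in K_span M -> exists X Y : modA A,
  [/\ in_add M X, in_add M Y & x = K_class X - K_class Y].
Proof.
have a0 : in_add M (zero_mod A) by apply: in_add_trivial; exact: zero_mod_trivial.
move=> /asboolP/(_ (fun x => `[< exists X Y : modA A,
  [/\ in_add M X, in_add M Y & x = K_class X - K_class Y] >])) h.
apply/asboolP; apply: h => [|_ [X [_ _ sX ->]]].
  split=> [|y z /asboolP[X [Y [aX aY ->]]] /asboolP[X' [Y' [aX' aY' ->]]]];
    apply/asboolP.
    by exists (zero_mod A), (zero_mod A); rewrite subrr.
  exists (modA_prod X Y'), (modA_prod Y X').
  split; [exact: in_add_prod | exact: in_add_prod |].
  rewrite (K_class_prod (N := modA_prod X Y') (iso_refl _)).
  rewrite (K_class_prod (N := modA_prod Y X') (iso_refl _)).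
  by rewrite opprB opprD addrACA.
apply/asboolP; exists X, (zero_mod A); split=> //.
  by apply: retract_in_add; exact/direct_summandP.
by rewrite (K_class_projective (projective_trivial (@zero_mod_trivial A))) subr0.
Qed.

Lemma indecomposable_summand X : ~ trivial_module X ->
  exists2 W : modA A, indecomposable W & retract W X.
Proof.
elim/modA_ind: X => [X //|X iX _|X S T iso IS IT nX].
  by exists X => //; exact: retract_iso (iso_refl X).
have [S0|/IS[W iW rW]] := pselect (trivial_module S); last first.
  exists W => //; apply: retract_trans rW _.
  exact: retract_trans (retract_prodl S T) (retract_iso (iso_sym iso)).
have [T0|/IT[W iW rW]] := pselect (trivial_module T); last first.
  exists W => //; apply: retract_trans rW _.
  exact: retract_trans (retract_prodr S T) (retract_iso (iso_sym iso)).
case: nX; apply: iso_trivial (iso_sym iso) _ => -[s t].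
by rewrite (S0 s) (T0 t).
Qed.

(** A common summand of X and Y can be split off from both without changing
    [X] - [Y], and this shortens X. *)
Lemma K_class_disjoint M X Y : in_add M X -> in_add M Y -> exists X' Y' : modA A,
  [/\ in_add M X', in_add M Y', K_class X - K_class Y = K_class X' - K_class Y'
    & forall Z : modA A, in_add X' Z -> in_add Y' Z -> trivial_module Z].
Proof.
have [n lX] := modA_len lA X; elim: n X lX Y => [|n IH] X lX Y aX aY;
  have [dis|/existsNP[Z /not_implyP[ZX /not_implyP[ZY nZ]]]] := pselect
    (forall Z : modA A, in_add X Z -> in_add Y Z -> trivial_module Z);
  try by exists X, Y.
all: have [W iW rWZ] := indecomposable_summand nZ; have [nW _] := iW.
all: have [i [p /split_iso/modA_split[W1 [X1 [isoX [WW1 _]]]]]] :=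
  indecomposable_in_add iW (in_add_retract rWZ ZX).
all: have nW1 : ~ trivial_module W1
  by move=> W0; apply: nW; exact: iso_trivial (iso_sym WW1) W0.
all: have [m] := fin_len_summand (fin_len_iso (iso_trans isoX (iso_prodC _ _)) lX) nW1.
  by [].
move=> [<-] lX1.
have [j [q /split_iso/modA_split[W2 [Y1 [isoY [WW2 _]]]]]] :=
  indecomposable_in_add iW (in_add_retract rWZ ZY).
have [_ aX1] := in_add_factors isoX aX; have [_ aY1] := in_add_factors isoY aY.
have [X' [Y' [aX' aY' e dis]]] := IH X1 lX1 Y1 aX1 aY1.
exists X', Y'; split=> //; rewrite -e (K_class_prod isoX) (K_class_prod isoY).
by rewrite (K_class_iso (iso_trans (iso_sym WW1) WW2)) opprD addrACA subrr add0r.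
Qed.

(** An indecomposable summand of a direct sum is a summand of one of the terms, so
    the classes of the terms of one decomposition of M suffice. *)
Lemma K_span_finite M : exists gs, forall x, x \in K_span M -> zspan gs x.
Proof.
suff [gs gsP] : exists gs : seq (K_group A), forall W : modA A,
    indecomposable W -> retract W M -> K_class W \in gs.
  exists gs => x /asboolP/(_ (fun x => `[< zspan gs x >])) h.
  apply/asboolP; apply: h => [|_ [W [iW _ /direct_summandP rW ->]]].
    have [S0 SB] := zspan_subgroup gs.
    by split=> [|y z /asboolP Sy /asboolP Sz]; apply/asboolP => //; exact: SB.
  by apply/asboolP/zspan_mem/gsP.
elim/modA_ind: M => [M M0|M iM|M S T iso [gs gsP] [gt gtP]].
- exists [::] => W [nW _] [i [p iK]]; case: nW => w.
  by rewrite -[w]iK (M0 (i w)) linear0.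
- exists [:: K_class M] => W [nW _] rW; rewrite inE; apply/eqP/K_class_iso.
  exact: indecomposable_retract rW.
exists (gs ++ gt) => W iW rW; rewrite mem_cat; apply/orP.
have [n lW] := modA_len lA W.
have [rS|rT] := retract_prod lW iW (retract_trans rW (retract_iso iso)).
  by left; exact: gsP.
by right; exact: gtP.
Qed.

End Span.

Section Stability.
Variables (A : nzRingType) (nA : nat).
Hypothesis lA : fin_len A^o nA.
Variables (Om : {additive K_group A -> K_group A}) (M : modA A).

(** Injectivity of Om on the n-th image of the span, read on the span itself. *)
Definition injective_at n := forall x, x \in K_span M ->
  iter n.+1 Om x = 0 -> iter n Om x = 0.

Lemma iter_additive n : zmod_morphism (iter n Om).
Proof. by move=> x y; elim: n => //= n ->; rewrite raddfB. Qed.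

Lemma iter_omega0 n : iter n Om 0 = 0.
Proof. by elim: n => //= n ->; rewrite raddf0. Qed.

Lemma syzygy_stableP k :
  syzygy_stable Om M k <-> forall n, (k <= n)%N -> injective_at n.
Proof.
have sM := K_span_subgroup M.
split=> h n kn.
  move=> x Mx x0; have [_ inj _] := h n kn.
  apply: inj; rewrite ?inE.
  - by exists x.
  - by exists 0; [exact: (proj1 sM) | exact: iter_omega0].
  - by rewrite raddf0.
split.
- by move=> _ [x Mx <-]; exists x.
- move=> y z; rewrite !inE => -[x Mx <-] [x' Mx' <-] e; apply/eqP.
  rewrite -subr_eq0 -iter_additive; apply/eqP/(h n kn).
    exact: (proj2 sM).
  by rewrite iter_additive; apply/eqP; rewrite subr_eq0; apply/eqP.
- by move=> _ [x Mx <-]; exists (iter n Om x) => //; exists x.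
Qed.

(** The kernels of the powers of Om on the span form an ascending chain. *)
Lemma syzygy_stable_exists : exists k, syzygy_stable Om M k.
Proof.
have [gs gsP] := K_span_finite lA M; have [S0 SB] := K_span_subgroup M.
have [|||k kP] := @zspan_acc _ gs (fun n => [set x | x \in K_span M /\ iter n Om x = 0]).
- move=> n; split=> [|x y [Mx x0] [My y0]]; first by split; [|exact: iter_omega0].
  by split; [exact: SB | rewrite iter_additive x0 y0 subrr].
- move=> m n /subnK <- x [Mx x0]; split=> //.
  by rewrite iterD x0 iter_omega0.
- by move=> n x [Mx _]; exact: gsP.
exists k; apply/syzygy_stableP => n kn x Mx x0.
have [//|_ xk] := kP n.+1 x.
by rewrite -(subnK kn) iterD xk iter_omega0.
Qed.

End Stability.

Theorem theorem3p6 (R : comNzRingType) (A : algType R) (hA : artin_algebra A)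
    (M : modA A) :
  exists2 k : nat, is_phi M k &
    is_max k ([set d : nat | (0 < d)%N /\
                 exists X Y : modA A, is_division d M X Y] `|` [set 0%N]).
Proof.
have [nA lA] : exists n, fin_len A^o n.
  apply: artin_fin_len hA _; exists 1%N, (fun=> 1) => x; exists (fun=> x).
  by rewrite big_ord1 -[RHS]/(x * 1) mulr1.
have [Om OmE] := omega_morphism lA.
have [k0 k0P] := syzygy_stable_exists lA Om M.
have ex : exists k, `[< syzygy_stable Om M k >] by exists k0; exact/asboolP.
case: (ex_minnP ex) => k /asboolP kP kmin.
have {}kmin m : syzygy_stable Om M m -> (k <= m)%N by move=> /asboolP/kmin.
exists k.
  exists Om; last by [].
  by move=> X N /(is_syzygy_class lA) ->.
have ExtE := Ext_iso_iter _ _ _ OmE.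
have diff n X Y : iter n Om (K_class X - K_class Y) = 0 <->
    iter n Om (K_class X) = iter n Om (K_class Y).
  by rewrite iter_additive; split=> [/eqP|->]; rewrite ?subrr // subr_eq0 => /eqP.
split.
  case: k kP kmin => [|k] kP kmin; first by right.
  left; split=> //.
  (* k.+1 is the least stable degree, so injectivity fails in degree k *)
  have : ~ injective_at Om M k.
    move=> ik; have := kmin k; rewrite ltnn => h; apply: notF; apply: h.
    apply/syzygy_stableP => n; rewrite leq_eqVlt => /predU1P[<-//|].
    by move: n; apply/syzygy_stableP.
  move=> /existsNP[x /not_implyP[Mx /not_implyP[xk1 xk]]].
  have [X0 [Y0 [aX0 aY0 xE]]] := K_span_difference Mx.
  have [X [Y [aX aY e dis]]] := K_class_disjoint lA aX0 aY0.
  rewrite xE e in xk1 xk; exists X, Y; split=> //.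
    by move=> /ExtE/diff.
  exact/ExtE/diff.
move=> d [[d0 [X [Y [[aX aY] _ nE E]]]]|->//].
case: d d0 nE E => // d _ nE E; rewrite ltnNge; apply/negP => kd.
apply: nE; apply/ExtE/diff.
move: kP => /syzygy_stableP/(_ d kd); apply.
  case: (K_span_subgroup M) => _; apply; [exact: (K_span_add lA aX) | exact: (K_span_add lA aY)].
exact/diff/ExtE.
Qed.
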